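(* Let $u$ be the minimizer of $$J[w]=\int_{B_1^+}(\Delta w)^2\,dx\,dy+\frac{2}{p}\int_{B_1'}\left(\lambda_-(w^-)^p+\lambda_+(w^+)^p\right)dx$$ over the set $\mathcal{A}=\{w\in W^{2,q}(B_1^+): w=g\text{ on }(\partial B_1)^+,\ w_y=0\text{ on }B_1'\}$. Then $u$ is a weak solution of the problem $$\Delta^2u=0\ \text{in }B_1^+,\quad u=g\ \text{on }(\partial B_1)^+,\quad u_y=0\ \text{on }B_1',\quad (\Delta u)_y=\lambda_-(u^-)^{p-1}-\lambda_+(u^+)^{p-1}\ \text{on }B_1'.$$
   Context: Points of $\mathbb{R}^{n+1}$ are written $z=(x,y)$ with $x\in\mathbb{R}^n$, $y\in\mathbb{R}$. $B_1$ is the unit ball of $\mathbb{R}^{n+1}$ centered at the origin, $B_1^+=B_1\cap\{y>0\}$, $(\partial B_1)^+=\partial B_1\cap\{y>0\}$, $B_1'=B_1\cap\{y=0\}$. $w^+=\max\{w,0\}$, $w^-=\max\{-w,0\}$. $\lambda_-,\lambda_+$ are positive constants, $p>1$, $q:=\max\{2,p\}$, and $g\in W^{2,q}(B_1^+)$ is given with $g_y=0$ on $B_1'$. Boundary conditions on Sobolev functions are in the sense of traces. Definition: $u\in W^{2,q}(B_1^+)$ is a weak solution of the problem $$\Delta^2u=0\ \text{in }B_1^+,\quad u=g\ \text{on }(\partial B_1)^+,\quad u_y=0\ \text{on }B_1',\quad (\Delta u)_y=\lambda_-(u^-)^{p-1}-\lambda_+(u^+)^{p-1}\ \text{on }B_1'$$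 if $$\int_{B_1^+}\Delta u\,\Delta\phi\,dx\,dy=\int_{B_1'}\left(\lambda_-(u^-)^{p-1}-\lambda_+(u^+)^{p-1}\right)\phi\,dx$$ for all functions $\phi\in C^\infty(\overline{B_1^+})$ such that $\phi=0$ on $(\partial B_1)^+$ and $\phi_y=0$ on $B_1'$. *)

(* Defs.v *)
From HB Require Import structures.
From mathcomp Require Import all_boot all_order all_algebra.
From mathcomp Require Import all_classical all_reals all_analysis.

Set Implicit Arguments.
Unset Strict Implicit.
Unset Printing Implicit Defensive.

Import Order.TTheory GRing.Theory Num.Theory.
Import numFieldNormedType.Exports.

Local Open Scope classical_set_scope.
Local Open Scope ring_scope.

(* The sigma-algebra on row vectors is the one generated by the coordinates;
   it is the Borel sigma-algebra of R^n. *)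
Section measurable_rV.
Context (R : realType) (n : nat).

Definition rV_coord (i : 'I_n) (x : 'rV[R]_n) : measurableTypeR R := x ord0 i.

Let rV_set0 : g_sigma_preimage rV_coord set0.
Proof. exact: sigma_algebra0. Qed.

Let rV_setC A : g_sigma_preimage rV_coord A -> g_sigma_preimage rV_coord (~` A).
Proof. exact: sigma_algebraC. Qed.

Let rV_bigcup (F : _^nat) : (forall i, g_sigma_preimage rV_coord (F i)) ->
  g_sigma_preimage rV_coord (\bigcup_i (F i)).
Proof. exact: sigma_algebra_bigcup. Qed.

HB.instance Definition _ :=
  @isMeasurable.Build (measure_tuple_display (sigma_display R.-ocitv.-measurable))
    'rV[R]_n (g_sigma_preimage rV_coord) rV_set0 rV_setC rV_bigcup.

End measurable_rV.

Lemma measurable_rV_coord (R : realType) n (i : 'I_n) :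
  measurable_fun [set: 'rV[R]_n] (@rV_coord R n i).
Proof.
move=> _ Y mY; rewrite setTI; apply: sub_sigma_algebra => /=.
rewrite -bigcup_seq/=; exists i => /=; first by rewrite mem_index_enum.
by exists Y => //; rewrite setTI.
Qed.

Lemma measurable_fun_rV_coord d (T : measurableType d) (R : realType) n
    (f : T -> 'rV[R]_n) :
  (forall i, measurable_fun [set: T] (@rV_coord R n i \o f)) ->
  measurable_fun [set: T] f.
Proof.
move=> mf _ A mA; rewrite setTI.
suff : g_sigma_preimage (@rV_coord R n) `<=` [set B | measurable (f @^-1` B)].
  exact.
apply: smallest_sub.
  split => /=.
  - by rewrite preimage_set0.
  - by move=> B mB; rewrite setTD preimage_setC; exact: measurableC.
  - by move=> F mF; rewrite preimage_bigcup; exact: bigcupT_measurable.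
rewrite -bigcup_seq/=; apply: bigcup_sub => i _ _ [B mB <-] /=.
rewrite setTI -comp_preimage -[X in measurable X]setTI.
exact: mf.
Qed.

Section lebesgue_measure_rV.
Context (R : realType).

Definition consrV n (t : measurableTypeR R * 'rV[R]_n) : 'rV[R]_n.+1 :=
  \row_i (if unlift ord0 i is Some j then t.2 ord0 j else t.1).

Definition unconsrV n (x : 'rV[R]_n.+1) : measurableTypeR R * 'rV[R]_n :=
  (x ord0 ord0, \row_j x ord0 (lift ord0 j)).

Lemma consrVK n : cancel (@consrV n) (@unconsrV n).
Proof.
move=> [t x]; congr pair; first by rewrite mxE unlift_none.
by apply/rowP => j; rewrite !mxE liftK.
Qed.

Lemma measurable_consrV n : measurable_fun [set: measurableTypeR R * 'rV[R]_n] (@consrV n).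
Proof.
apply: measurable_fun_rV_coord => i.
case: (unliftP ord0 i) => [j ->|->].
- rewrite (_ : _ \o _ = @rV_coord R n j \o snd).
    exact: measurableT_comp (@measurable_rV_coord R n j) measurable_snd.
  by apply/funext => t; rewrite /rV_coord /= mxE liftK.
- rewrite (_ : _ \o _ = fst); first exact: measurable_fst.
  by apply/funext => t; rewrite /rV_coord /= mxE unlift_none.
Qed.

Lemma measurable_unconsrV n : measurable_fun [set: 'rV[R]_n.+1] (@unconsrV n).
Proof.
apply: measurable_fun_pair; first exact: (@measurable_rV_coord R n.+1 ord0).
apply: measurable_fun_rV_coord => i.
rewrite (_ : _ \o _ = @rV_coord R n.+1 (lift ord0 i)).
  exact: measurable_rV_coord.
by apply/funext => x; rewrite /rV_coord /= mxE.
Qed.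

Section succ.
Context (n : nat) (mu : {sigma_finite_measure set 'rV[R]_n -> \bar R}).

Let nu : {measure set (measurableTypeR R * 'rV[R]_n)%type -> \bar R} :=
  (@lebesgue_measure R \x mu)%E.

Definition lebesgue_rVS : set 'rV[R]_n.+1 -> \bar R :=
  pushforward nu (@consrV n).

Let lebesgue_rVS0 : lebesgue_rVS set0 = 0%E.
Proof. by rewrite /lebesgue_rVS /pushforward preimage_set0 measure0. Qed.

Let lebesgue_rVS_ge0 A : (0 <= lebesgue_rVS A)%E.
Proof. exact: (measure_ge0 nu). Qed.

Let lebesgue_rVS_sigma_additive : semi_sigma_additive lebesgue_rVS.
Proof.
exact: (@measure_semi_sigma_additive _ _ _
  (measure_function_pushforward__canonical__measure_function_Measure nu
    (@measurable_consrV n))).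
Qed.

HB.instance Definition _ := isMeasure.Build _ _ _ lebesgue_rVS
  lebesgue_rVS0 lebesgue_rVS_ge0 lebesgue_rVS_sigma_additive.

Let lebesgue_rVS_sigma_finite : sigma_finite setT lebesgue_rVS.
Proof.
have /sigma_finiteP[F [TF ndF Foo]] := sigma_finiteT (@lebesgue_measure R).
have /sigma_finiteP[G [TG ndG Goo]] := sigma_finiteT mu.
exists (fun k => @unconsrV n @^-1` (F k `*` G k)).
  rewrite -preimage_bigcup (_ : \bigcup_i _ = setT) ?preimage_setT//.
  apply/seteqP; split=> // -[x y] _.
  have [k _ Fkx] : (\bigcup_k F k) x by rewrite -TF.
  have [l _ Gly] : (\bigcup_l G l) y by rewrite -TG.
  exists (maxn k l) => //; split => /=.
  - by move: x Fkx {y Gly}; exact/subsetPset/ndF/leq_maxl.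
  - by move: y Gly {x Fkx}; exact/subsetPset/ndG/leq_maxr.
move=> k; have [mF Fk] := Foo k; have [mG Gk] := Goo k; split.
  rewrite -[X in measurable X]setTI; apply: measurable_unconsrV => //.
  exact: measurableX.
rewrite /lebesgue_rVS /pushforward -comp_preimage.
rewrite (_ : @unconsrV n \o @consrV n = id); last first.
  by apply/funext => t /=; rewrite consrVK.
rewrite preimage_id /= product_measure1E//.
by rewrite lte_mul_pinfty// ge0_fin_numE.
Qed.

HB.instance Definition _ := Measure_isSigmaFinite.Build _ _ _ lebesgue_rVS
  lebesgue_rVS_sigma_finite.

End succ.

Fixpoint lebesgue_rV n : {sigma_finite_measure set 'rV[R]_n -> \bar R} :=
  match n with
  | 0 => \d_(0 : 'rV[R]_0)
  | m.+1 => lebesgue_rVS (lebesgue_rV m)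
  end.

Lemma lebesgue_rV_box n (A : 'I_n -> set (measurableTypeR R)) :
  (forall i, measurable (A i)) ->
  lebesgue_rV n [set x | forall i, A i (x ord0 i)] =
  (\prod_(i < n) lebesgue_measure (A i))%E.
Proof.
elim: n A => [|n IHn] A mA.
  rewrite big_ord0 /= diracE mem_set//; by case.
rewrite big_ord_recl.
pose B := [set y : 'rV[R]_n | forall i, A (lift ord0 i) (y ord0 i)].
transitivity ((@lebesgue_measure R \x lebesgue_rV n)%E (A ord0 `*` B)).
  congr product_measure1.
  apply/seteqP; split=> -[t y] /=.
    move=> h; split; first by have := h ord0; rewrite mxE unlift_none.
    by move=> i; have := h (lift ord0 i); rewrite mxE liftK.
  move=> [h0 h] i; rewrite mxE.
  by case: (unliftP ord0 i) => [j ->|->].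
rewrite product_measure1E//; last first.
  rewrite (_ : B = \big[setI/setT]_(i < n)
      (@rV_coord R n i @^-1` A (lift ord0 i))).
    apply: bigsetI_measurable => i _; rewrite -[X in measurable X]setTI.
    exact: measurable_rV_coord.
  apply/seteqP; split => y; rewrite -bigcap_seq /=.
    by move=> h i _; exact: h.
  by move=> h i; apply: h; rewrite /= mem_index_enum.
by congr (_ * _)%E; exact: (IHn (fun i => A (lift ord0 i))).
Qed.

End lebesgue_measure_rV.

Section half_ball.
Context (R : realType) (n : nat).

(* Points of R^(n+1) are pairs z = (x, y). *)
Local Notation E := ('rV[R]_n * R)%type.

Definition lebesgue_E :
    {measure set ('rV[R]_n * measurableTypeR R)%type -> \bar R} :=
  (lebesgue_rV R n \x @lebesgue_measure R)%E.

(* The norm of 'rV and of products is the sup norm in the library, hence the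
   explicit Euclidean norms below. *)
Definition sqnorm (x : 'rV[R]_n) : R := \sum_(i < n) x ord0 i ^+ 2.

Definition unit_ball : set 'rV[R]_n := [set x | sqnorm x < 1].

Definition half_ball : set E :=
  [set z | sqnorm z.1 + z.2 ^+ 2 < 1 /\ 0 < z.2].

Definition flat_boundary : set E :=
  [set z | sqnorm z.1 + z.2 ^+ 2 < 1 /\ z.2 = 0].

Definition cap_boundary : set E :=
  [set z | sqnorm z.1 + z.2 ^+ 2 = 1 /\ 0 < z.2].

(* A boundary piece given as a graph over the unit ball of R^n, together with
   its area element; bint P F is the surface integral of F over P. *)
Record bpiece := BPiece { bparam : 'rV[R]_n -> E ; barea : 'rV[R]_n -> R }.

Definition flat : bpiece := BPiece (fun x => (x, 0)) (fun=> 1).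

(* cap_boundary is the graph of h(x) = sqrt (1 - |x|^2), with area element
   sqrt (1 + |grad h|^2) = 1 / sqrt (1 - |x|^2) *)
Definition cap : bpiece :=
  BPiece (fun x => (x, Num.sqrt (1 - sqnorm x)))
         (fun x => (Num.sqrt (1 - sqnorm x))^-1).

Definition bint (P : bpiece) (F : E -> R) : \bar R :=
  (\int[lebesgue_rV R n]_(x in unit_ball) (F (bparam P x) * barea P x)%:E)%E.

(* Some i is the direction of x_i, None the direction of y. *)
Definition dir (i : option 'I_n) : E :=
  if i is Some j then (delta_mx ord0 j, 0) else (0, 1).

Fixpoint pderiv (s : seq (option 'I_n)) (f : E -> R) : E -> R :=
  if s is i :: s' then 'D_(dir i) (pderiv s' f) else f.

Definition laplacian (f : E -> R) : E -> R :=
  fun z => \sum_(i : option 'I_n) pderiv [:: i; i] f z.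

Definition smooth_on (U : set E) (f : E -> R) : Prop :=
  forall s z, U z ->
    {for z, continuous (pderiv s f)} /\
    forall i, derivable (pderiv s f) z (dir i).

(* f is C^oo on the closure of the open set U: f is smooth on U, and f and all
   its partial derivatives extend continuously to the closure, the extension
   of f being f itself *)
Definition smooth_upto (U : set E) (f : E -> R) : Prop :=
  [/\ smooth_on U f,
      {within closure U, continuous f} &
      forall s, exists h : E -> R,
        {within closure U, continuous h} /\
        forall z, U z -> h z = pderiv s f z].

Definition test_fun (U : set E) (f : E -> R) : Prop :=
  smooth_on setT f /\
  exists K : set E, [/\ compact K, K `<=` U & forall z, ~ K z -> f z = 0].

(* Sobolev functions and their traces are represented by functions defined
   everywhere; only their a.e. classes matter. *)

Definition Lq_half_ball (q : R) (f : E -> R) : Prop :=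
  measurable_fun (half_ball : set ('rV[R]_n * measurableTypeR R)) f /\
  (\int[lebesgue_E]_(z in half_ball) (`|f z| `^ q)%:E < +oo)%E.

(* v is the weak derivative of w along the multi-index (written as a word of
   directions) s, and belongs to L^q *)
Definition is_wderiv (q : R) (s : seq (option 'I_n)) (w v : E -> R) : Prop :=
  Lq_half_ball q v /\
  forall eta, test_fun half_ball eta ->
    \int[lebesgue_E]_(z in half_ball) (w z * pderiv s eta z) =
    (-1) ^+ size s * \int[lebesgue_E]_(z in half_ball) (v z * eta z).

Definition sobolev (k : nat) (q : R) (w : E -> R) : Prop :=
  Lq_half_ball q w /\
  forall s, (size s <= k)%N -> exists v, is_wderiv q s w v.

Definition is_wlaplacian (q : R) (w L : E -> R) : Prop :=
  exists2 v : option 'I_n -> E -> R,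
    (forall i, is_wderiv q [:: i; i] w (v i)) &
    L = fun z => \sum_i v i z.

Definition Lq_cvg (q : R) (f : nat -> E -> R) (w : E -> R) : Prop :=
  (fun k => \int[lebesgue_E]_(z in half_ball) (`|f k z - w z| `^ q)%:E)%E
    @ \oo --> 0%E.

(* T is the trace on P of w in W^{1,q}: the trace operator is the continuous
   extension to W^{1,q} of the restriction to the boundary of the functions
   smooth up to the boundary. *)
Definition is_trace (q : R) (P : bpiece) (w T : E -> R) : Prop :=
  [/\ measurable_fun unit_ball (T \o bparam P),
      (bint P (fun z => `|T z| `^ q)%R < +oo)%E &
      exists f : nat -> E -> R,
        [/\ forall k, smooth_upto half_ball (f k),
            Lq_cvg q f w,
            forall i, exists2 v, is_wderiv q [:: i] w v &
              Lq_cvg q (fun k => pderiv [:: i] (f k)) v &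
            (fun k => bint P (fun z => `|f k z - T z| `^ q)%R) @ \oo --> 0%E]].

Definition trace_eq (q : R) (P : bpiece) (w1 w2 : E -> R) : Prop :=
  exists2 T, is_trace q P w1 T & is_trace q P w2 T.

Definition flat_neumann (q : R) (w : E -> R) : Prop :=
  exists2 v, is_wderiv q [:: None] w v & is_trace q flat v (cst 0).

Definition pos_part (r : R) : R := Num.max r 0.
Definition neg_part (r : R) : R := Num.max (- r) 0.

Definition qexp (p : R) : R := Num.max 2 p.

Definition admissible (p : R) (g w : E -> R) : Prop :=
  [/\ sobolev 2 (qexp p) w,
      trace_eq (qexp p) cap w g &
      flat_neumann (qexp p) w].

(* J[w] = j. The weak Laplacian L and the trace T of w are unique up to null
   sets, so that j is determined by w. *)
Definition is_J (lneg lpos p : R) (w : E -> R) (j : \bar R) : Prop :=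
  exists L T,
    [/\ is_wlaplacian (qexp p) w L, is_trace (qexp p) flat w T &
      j = (\int[lebesgue_E]_(z in half_ball) (L z ^+ 2)%:E +
           (2 / p)%:E *
           bint flat (fun z => lneg * neg_part (T z) `^ p +
                               lpos * pos_part (T z) `^ p)%R)%E].

Definition is_minimizer (lneg lpos p : R) (g u : E -> R) : Prop :=
  admissible p g u /\
  exists2 j, is_J lneg lpos p u j &
    forall w j', admissible p g w -> is_J lneg lpos p w j' -> (j <= j')%E.

(* As for is_J, L and T stand for the weak Laplacian and the trace of u. *)
Definition weak_solution (lneg lpos p : R) (g u : E -> R) : Prop :=
  [/\ sobolev 2 (qexp p) u,
      trace_eq (qexp p) cap u g,
      flat_neumann (qexp p) u &
      exists L T,
        [/\ is_wlaplacian (qexp p) u L, is_trace (qexp p) flat u T &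
          forall phi : E -> R,
            smooth_upto half_ball phi ->
            (forall z, cap_boundary z -> phi z = 0) ->
            (* phi_y is only a limit from the inside on the flat boundary *)
            (forall z, flat_boundary z ->
               pderiv [:: None] phi @ within half_ball (nbhs z) --> (0 : R)) ->
            \int[lebesgue_E]_(z in half_ball) (L z * laplacian phi z) =
            \int[lebesgue_rV R n]_(x in unit_ball)
              ((lneg * neg_part (T (x, 0)) `^ (p - 1) -
                lpos * pos_part (T (x, 0)) `^ (p - 1)) * phi (x, 0))]].

End half_ball.

(* Main.v *)
(* For a test function phi, every w = u + t phi is a competitor. The boundary
   energy G s = lneg (s^-)^p + lpos (s^+)^p is convex with G' = - p F, where F
   is the boundary force, so G (T + t phi) - G T <= - p t phi F (T + t phi) on
   the flat boundary, and J[u] <= J[u + t phi] gives for t > 0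
     \int phi F (T + t phi) <= \int L (lap phi) + (t / 2) \int (lap phi)^2.
   Dominated convergence as t -> 0+ yields one inequality, and replacing phi by
   - phi yields the other. That w is a competitor rests on integration by parts
   against test functions, i.e. on the vanishing of the integral of a partial
   derivative of a compactly supported function: by translation invariance the
   integrals of its difference quotients vanish, and these converge dominatedly
   to the partial derivative. *)

Require Import Defs.
From mathcomp Require Import all_boot all_order all_algebra ring lra.
From mathcomp Require Import all_classical all_reals all_analysis.
From mathcomp Require Import measurable_realfun.
Import Order.TTheory GRing.Theory Num.Theory.
Import numFieldNormedType.Exports.
Local Open Scope classical_set_scope.
Local Open Scope ring_scope.

Set Implicit Arguments.
Unset Strict Implicit.
Unset Printing Implicit Defensive.

(** * Lebesgue classes on a set of finite measure *)

(** Taking the tangent of [G] at the displaced trace leaves a limit in which only the continuity of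
    [F] enters, so that [p < 2], where [F] is not differentiable at 0, is treated like the other
    exponents. The exponent [q = max(2, p)] makes both terms of the energy finite, which allows J[u]
    to be cancelled. Two features of the encoding shape the rest. The sigma-algebras are generated
    by coordinates, so open sets have to be shown measurable before continuous functions can be
    integrated. Functions are defined on the whole space with arbitrary values off the half ball.
    Hence the whole-space argument for integration by parts is applied to the product of a smooth
    function with a test function, which vanishes near every point outside the half ball; and the
    trace of the normal derivative of [phi] is read off a continuous extension from the inside,
    since [pderiv] at a boundary point also depends on values of [phi] beyond the boundary. *)

Section finite_measure_Lq.
Context d (T : measurableType d) (R : realType).
Variables (mu : {measure set T -> \bar R}) (D : set T).
Hypotheses (mD : measurable D) (finD : (mu D < +oo)%E).
Implicit Types (f g : T -> R) (q r M : R).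

Definition Lq q f :=
  measurable_fun D f /\ (\int[mu]_(x in D) (`|f x| `^ q)%:E < +oo)%E.

Lemma integrable_dominated f g : measurable_fun D f ->
  (forall x, D x -> `|f x| <= g x) -> mu.-integrable D (EFin \o g) ->
  mu.-integrable D (EFin \o f).
Proof.
move=> mf fg; apply: le_integrable => //; first exact/measurable_EFinP.
by move=> x Dx /=; rewrite lee_fin (le_trans (fg x Dx))// ler_norm.
Qed.

Lemma integrable_bounded f M : measurable_fun D f ->
  (forall x, D x -> `|f x| <= M) -> mu.-integrable D (EFin \o f).
Proof.
move=> mf fM; apply: measurable_bounded_integrable => //.
exists M; split; first exact: num_real.
by move=> N MN x Dx /=; rewrite (le_trans (fM x Dx))// ltW.
Qed.

(** Source of the inclusion of L^q in L^r on a set of finite measure: the summand 1 takes care of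
    [x < 1], the power [q] of [1 <= x]. *)
Lemma powR_le1D r q (x : R) : 0 <= x -> 0 <= r -> r <= q ->
  x `^ r <= 1 + x `^ q.
Proof.
move=> x0 r0 rq; have [x1|x1] := leP 1 x.
  by rewrite (le_trans (ler_powR x1 rq))// ler_wpDl.
rewrite (@le_trans _ _ (1 `^ r))//; last by rewrite powR1 lerDl powR_ge0.
by apply: ge0_ler_powR => //; [rewrite nnegrE|exact: ltW].
Qed.

(** The norm of a sum is at most twice the larger of the two norms. This crude constant is enough
    for the stability of L^q under addition. *)
Lemma powR_norm_leD q (x y : R) : 0 <= q ->
  `|x + y| `^ q <= (2 : R) `^ q * (`|x| `^ q + `|y| `^ q).
Proof.
move=> q0.
have h (a b : R) : `|a| <= `|b| ->
    `|a + b| `^ q <= (2 : R) `^ q * (`|a| `^ q + `|b| `^ q).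
  move=> ab; rewrite (@le_trans _ _ ((2 * `|b|) `^ q))//.
    apply: ge0_ler_powR => //; rewrite ?nnegrE ?mulr_ge0//.
    by rewrite (le_trans (ler_normD _ _))// mulr_natl mulr2n lerD2r.
  by rewrite powRM// ler_wpM2l ?powR_ge0// lerDr powR_ge0.
have [/h//|/ltW/h] := leP `|x| `|y|.
by rewrite addrC [in X in _ * X]addrC.
Qed.

Lemma measurable_powR_norm f q : measurable_fun D f ->
  measurable_fun D (fun x => `|f x| `^ q).
Proof.
move=> mf; apply: (measurableT_comp (measurable_powR q)).
exact: measurableT_comp.
Qed.

Lemma Lq_integrable_powR f q : Lq q f ->
  mu.-integrable D (EFin \o (fun x => `|f x| `^ q)).
Proof.
move=> [mf foo]; apply/integrableP; split.
  exact/measurable_EFinP/measurable_powR_norm.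
apply: le_lt_trans foo; apply: ge0_le_integral => //=.
- by apply/measurable_EFinP/measurableT_comp => //; exact: measurable_powR_norm.
- exact/measurable_EFinP/measurable_powR_norm.
- by move=> x _; rewrite lee_fin ger0_norm// powR_ge0.
Qed.

Lemma integrable_1D f : mu.-integrable D (EFin \o f) ->
  mu.-integrable D (EFin \o (fun x => 1 + f x)).
Proof.
move=> fi; have i1 : mu.-integrable D (EFin \o cst 1).
  by apply: (@integrable_bounded _ 1) => // x _; rewrite normr1.
exact: eq_integrable (integrableD mD i1 fi).
Qed.

Lemma Lq_integrable_le f q r : 0 <= r -> r <= q -> Lq q f ->
  mu.-integrable D (EFin \o (fun x => `|f x| `^ r)).
Proof.
move=> r0 rq fL; have [mf _] := fL.
apply: (@integrable_dominated _ (fun x => 1 + `|f x| `^ q)).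
- exact: measurable_powR_norm.
- by move=> x _; rewrite ger0_norm ?powR_ge0// powR_le1D.
- exact/integrable_1D/Lq_integrable_powR.
Qed.

Lemma Lq_integrable f q : 1 <= q -> Lq q f -> mu.-integrable D (EFin \o f).
Proof.
move=> q1 fL; have [mf _] := fL.
apply: (@integrable_dominated _ (fun x => `|f x| `^ 1)) => //.
  by move=> x _; rewrite powRr1.
exact: Lq_integrable_le fL.
Qed.

Lemma LqD f g q : 0 <= q -> Lq q f -> Lq q g -> Lq q (f \+ g).
Proof.
move=> q0 fL gL; have [mf _] := fL; have [mg _] := gL.
split; first exact: measurable_funD.
apply: (@le_lt_trans _ _ (\int[mu]_(x in D)
   (((2 : R) `^ q)%:E * ((`|f x| `^ q)%:E + (`|g x| `^ q)%:E)))%E).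
  apply: ge0_le_integral => //=.
  - exact/measurable_EFinP/measurable_powR_norm/measurable_funD.
  - by apply: emeasurable_funM => //; apply: emeasurable_funD;
      exact/measurable_EFinP/measurable_powR_norm.
  - by move=> x _; rewrite lee_fin powR_norm_leD.
apply: integrable_lty => //; apply: integrableZl => //.
by apply: integrableD => //; exact: Lq_integrable_powR.
Qed.

Lemma LqZ f t q : Lq q f -> Lq q (fun x => t * f x).
Proof.
move=> fL; have [mf _] := fL; split; first exact: measurable_funM.
under eq_integral do rewrite normrM powRM// EFinM.
apply: integrable_lty => //; apply: integrableZl => //.
exact: Lq_integrable_powR.
Qed.

Lemma Lq_bounded g M q : 0 <= q -> measurable_fun D g ->
  (forall x, D x -> `|g x| <= M) -> Lq q g.
Proof.
move=> q0 mg gM; split => //; apply: integrable_lty => //.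
apply: (@integrable_bounded _ (M `^ q)); first exact: measurable_powR_norm.
move=> x Dx; rewrite ger0_norm ?powR_ge0//; apply: ge0_ler_powR => //.
  by rewrite nnegrE (le_trans (normr_ge0 (g x)))// gM.
exact: gM.
Qed.

Lemma Lq_sum (I : Type) (r : seq I) (F : I -> T -> R) q : 0 <= q ->
  (forall i, Lq q (F i)) -> Lq q (fun x => \sum_(i <- r) F i x).
Proof.
move=> q0 FL; elim: r => [|i r IHr].
  under eq_fun do rewrite big_nil.
  by apply: (@Lq_bounded _ 0) => // x _; rewrite normr0.
under eq_fun do rewrite big_cons.
exact: (LqD q0 (FL i) IHr).
Qed.

Lemma integrable_Lq_bounded f g q M : 1 <= q -> Lq q f -> measurable_fun D g ->
  (forall x, D x -> `|g x| <= M) -> mu.-integrable D (EFin \o (f \* g)).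
Proof.
move=> q1 fL mg gM; have [mf _] := fL.
apply: (@integrable_dominated _ (fun x => `|f x| * M)).
- exact: measurable_funM.
- by move=> x Dx; rewrite normrM ler_wpM2l// gM.
have := @integrableZr _ _ _ mu D mD M (EFin \o (fun x => `|f x|)).
move=> h; apply: eq_integrable (h _) => //.
by apply/integrable_norm => //; exact: Lq_integrable fL.
Qed.

Lemma Lq_integrable_sqr f q : 2 <= q -> Lq q f ->
  mu.-integrable D (EFin \o (fun x => f x ^+ 2)).
Proof.
move=> q2 fL; have := @Lq_integrable_le f q 2 _ q2 fL.
move=> h; apply: eq_integrable (h _) => //.
by move=> x _ /=; rewrite powR_mulrn// real_normK// num_real.
Qed.

Lemma Rintegral_mulrN f g : mu.-integrable D (EFin \o (f \* g)) ->
  \int[mu]_(x in D) (f x * - g x) = - \int[mu]_(x in D) (f x * g x).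
Proof.
move=> fgi; rewrite -mulN1r -(RintegralZl (-1) mD fgi).
by apply: eq_Rintegral => x _; rewrite mulrN mulN1r.
Qed.

End finite_measure_Lq.

(** * The boundary energy and the first variation *)

Section boundary_energy.
Context (R : realType).
Variables (lneg lpos p : R).
Hypotheses (lneg0 : 0 <= lneg) (lpos0 : 0 <= lpos) (p1 : 1 < p).
Implicit Types a b s : R.

Definition boundary_energy s := lneg * neg_part s `^ p + lpos * pos_part s `^ p.

Definition boundary_force s :=
  lneg * neg_part s `^ (p - 1) - lpos * pos_part s `^ (p - 1).

Let p0 : 0 < p. Proof. by rewrite (lt_trans _ p1). Qed.
Let pB1 : 0 < p - 1. Proof. by rewrite subr_gt0. Qed.

Lemma pos_part_ge0 s : 0 <= pos_part s.
Proof. by rewrite le_max lexx orbT. Qed.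

Lemma neg_partE s : neg_part s = pos_part (- s). Proof. by []. Qed.

Lemma pos_part_le_norm s : pos_part s <= `|s|.
Proof. by rewrite ge_max ler_norm normr_ge0. Qed.

(* Young's inequality for the conjugate exponents [p] and [p / (p - 1)]. *)
Lemma powR_tangent a b : 0 <= a -> 0 <= b ->
  a `^ p + p * a `^ (p - 1) * (b - a) <= b `^ p.
Proof.
move=> a0 b0.
have q0 : 0 < p / (p - 1) by rewrite divr_gt0.
have pN0 : p != 0 by rewrite gt_eqF.
have pBN0 : p - 1 != 0 by rewrite gt_eqF.
have pq : p^-1 + (p / (p - 1))^-1 = 1 by field; rewrite ?pN0 ?pBN0.
(* Young for [b] and [a ^ (p - 1)]; the conjugate exponent turns the power of the second factor back
   into [a ^ p]. *)
have := conjugate_powR b0 (powR_ge0 a (p - 1)) p0 q0 pq.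
rewrite -powRrM (_ : (p - 1) * (p / (p - 1)) = p); last by field.
rewrite -(ler_pM2l p0) => h; rewrite mulrBr.
rewrite -[p * _ * a]mulrA [_ `^ (p - 1) * a]mulrC (mulr_powRB1 a0 p0).
move: h; rewrite (_ : p * (_ + _) = b `^ p + (p - 1) * a `^ p); last first.
  by field; rewrite ?pN0 ?pBN0.
by rewrite -mulrA [b * _]mulrC; lra.
Qed.

(** For [a <= 0] the tangent is the zero line, because [0 < p - 1]. For [0 < a] the slope is
    nonnegative, so [b] may be replaced by the larger [pos_part b]. *)
Lemma pos_part_tangent a b :
  pos_part a `^ p + p * pos_part a `^ (p - 1) * (b - a) <= pos_part b `^ p.
Proof.
have [a0|a0] := leP a 0.
  have -> : pos_part a = 0 by apply/max_idPr.
  by rewrite !powR0 ?gt_eqF// mulr0 mul0r addr0 powR_ge0.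
have -> : pos_part a = a by apply/max_idPl/ltW.
apply: le_trans (powR_tangent (ltW a0) (pos_part_ge0 b)).
rewrite lerD2l ler_wpM2l ?mulr_ge0 ?powR_ge0 ?(ltW p0)// lerD2r.
by rewrite le_max lexx.
Qed.

(** The negative part is the positive part of the opposite, so its tangent has the opposite slope;
    this produces the two signs in [boundary_force]. *)
Lemma boundary_energy_tangent a b :
  boundary_energy a - p * boundary_force a * (b - a) <= boundary_energy b.
Proof.
have hp := ler_wpM2l lpos0 (pos_part_tangent a b).
have hn := ler_wpM2l lneg0 (pos_part_tangent (- a) (- b)).
rewrite /boundary_energy /boundary_force !neg_partE.
by move: hp hn; set A := pos_part a `^ p; set B := pos_part (- a) `^ p;
  set A' := pos_part a `^ _; set B' := pos_part (- a) `^ _; lra.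
Qed.

Lemma boundary_energy_ge0 s : 0 <= boundary_energy s.
Proof. by rewrite addr_ge0// mulr_ge0// powR_ge0. Qed.

Lemma powR_pos_part_le s r : 0 <= r -> pos_part s `^ r <= `|s| `^ r.
Proof.
by move=> r0; apply: ge0_ler_powR;
  rewrite ?nnegrE ?pos_part_ge0 ?pos_part_le_norm.
Qed.

Lemma boundary_energy_le s : boundary_energy s <= (lneg + lpos) * `|s| `^ p.
Proof.
rewrite mulrDl lerD// ler_wpM2l// ?powR_pos_part_le ?(ltW p0)//.
by rewrite neg_partE -normrN powR_pos_part_le ?(ltW p0).
Qed.

Lemma boundary_force_le s :
  `|boundary_force s| <= (lneg + lpos) * `|s| `^ (p - 1).
Proof.
have h (l : R) (x : R) : 0 <= l ->
    `|l * pos_part x `^ (p - 1)| <= l * `|x| `^ (p - 1).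
  move=> l0; rewrite normrM (ger0_norm l0) (ger0_norm (powR_ge0 _ _)).
  by rewrite ler_wpM2l// powR_pos_part_le// ltW.
rewrite (le_trans (ler_normB _ _))// mulrDl lerD ?h//.
by rewrite neg_partE -[`|s|]normrN h.
Qed.

(** The exponent of interest is [p - 1], which may be below 1; then differentiability fails at 0,
    and continuity there is obtained from the radius [e ^ (1/r)]. At positive points the power
    function is differentiable. *)
Lemma continuous_pos_part_powR r : 0 < r ->
  continuous (fun s : R => pos_part s `^ r).
Proof.
move=> r0 s; rewrite /continuous_at /=; have [s0|s0] := leP s 0.
  have -> : pos_part s = 0 by apply/max_idPr.
  rewrite powR0 ?gt_eqF//.
  apply/cvgrPdist_lt => /= e e0.
  have e'0 : 0 < e `^ r^-1 by exact: powR_gt0.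
  near=> x; rewrite sub0r normrN ger0_norm ?powR_ge0//.
  rewrite -[ltRHS]powRr1 ?(ltW e0)// -(mulVf (lt0r_neq0 r0)) powRrM.
  apply: gt0_ltr_powR => //; rewrite ?nnegrE ?powR_ge0 ?pos_part_ge0//.
  rewrite gt_max e'0 andbT.
  by near: x; apply: lt_nbhsl; exact: le_lt_trans e'0.
apply: (@cvg_trans _ ((fun x : R => x `^ r) x @[x --> s])).
  apply: near_eq_cvg; near=> x.
  suff -> : pos_part x = x by [].
  by apply/max_idPl/ltW; near: x; exact: lt_nbhsr.
have -> : pos_part s = s by apply/max_idPl/ltW.
have [+ _] := is_derive1_powR r s0.
by move=> /derivable1_diffP/differentiable_continuous.
Unshelve. all: by end_near. Qed.

Lemma continuous_boundary_force : continuous boundary_force.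
Proof.
move=> s; apply: cvgB; (apply: cvgM; first exact: cvg_cst).
  apply: (@cvg_comp _ _ _ (fun x : R => - x) (fun x => pos_part x `^ (p - 1))).
    exact: opp_continuous.
  exact: continuous_pos_part_powR.
exact: continuous_pos_part_powR.
Qed.

End boundary_energy.

(** * The one-sided variational inequality, on abstract measure spaces *)

Section first_variation.
Context d1 (T1 : measurableType d1) d2 (T2 : measurableType d2) (R : realType).
Variables (mu : {measure set T1 -> \bar R}) (D : set T1).
Variables (nu : {measure set T2 -> \bar R}) (B : set T2).
Hypotheses (mD : measurable D) (finD : (mu D < +oo)%E).
Hypotheses (mB : measurable B) (finB : (nu B < +oo)%E).
Variables (lneg lpos p : R).
Hypotheses (lneg0 : 0 <= lneg) (lpos0 : 0 <= lpos) (p1 : 1 < p).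

Local Notation G := (boundary_energy lneg lpos p).
Local Notation g := (boundary_force lneg lpos p).
Local Notation q := (qexp p).

Let q2 : 2 <= q. Proof. by rewrite le_max lexx. Qed.
Let pq : p <= q. Proof. by rewrite le_max lexx orbT. Qed.
Let q0 : 0 <= q. Proof. exact: le_trans q2. Qed.
Let q1 : 1 <= q. Proof. by rewrite (le_trans (ltW p1)). Qed.
Let p0 : 0 < p. Proof. exact: lt_trans p1. Qed.

Lemma measurable_boundary_energy : measurable_fun setT G.
Proof.
apply: measurable_funD; apply: measurable_funM => //;
  apply: (measurableT_comp (measurable_powR p)); apply: measurable_maxr => //.
Qed.

Lemma measurable_boundary_force : measurable_fun setT g.
Proof.
apply: measurable_funB; apply: measurable_funM => //;
  apply: (measurableT_comp (measurable_powR (p - 1)));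
  apply: measurable_maxr => //.
Qed.

Lemma integrable_boundary_energy T : Lq nu B q T ->
  nu.-integrable B (EFin \o (fun x => G (T x))).
Proof.
move=> TL; have [mT _] := TL.
apply: (@integrable_dominated _ _ _ _ _ mB _
  (fun x => (lneg + lpos) * `|T x| `^ p)).
- exact: (measurableT_comp measurable_boundary_energy).
- by move=> x _; rewrite ger0_norm ?boundary_energy_ge0// boundary_energy_le.
have := @integrableZl _ _ _ nu B mB (lneg + lpos)
  (EFin \o (fun x => `|T x| `^ p)).
by apply; exact: (Lq_integrable_le mB finB (ltW p0) pq).
Qed.

Lemma integrable_boundary_force (T phi : T2 -> R) (M : R) : Lq nu B q T ->
  measurable_fun B phi -> (forall x, B x -> `|phi x| <= M) ->
  nu.-integrable B (EFin \o (fun x => g (T x) * phi x)).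
Proof.
move=> TL mphi phiM; have [mT _] := TL.
apply: (@integrable_dominated _ _ _ _ _ mB _
  (fun x => (lneg + lpos) * M * `|T x| `^ (p - 1))).
- apply: measurable_funM => //.
  exact: (measurableT_comp measurable_boundary_force).
- move=> x Bx; rewrite normrM mulrAC ler_pM ?normr_ge0 ?phiM//.
  exact: boundary_force_le.
have := @integrableZl _ _ _ nu B mB ((lneg + lpos) * M)
  (EFin \o (fun x => `|T x| `^ (p - 1))).
apply; apply: (Lq_integrable_le mB finB _ _ TL).
  by rewrite subr_ge0 ltW.
by rewrite lerBlDr (le_trans pq)// lerDl.
Qed.

(** J as a functional of a pair (Laplacian, trace) on two unrelated measure spaces: the first
    variation uses no link between [L] and [T]. *)
Definition energy (L : T1 -> R) (T : T2 -> R) : \bar R :=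
  (\int[mu]_(z in D) (L z ^+ 2)%:E +
   (2 / p)%:E * \int[nu]_(x in B) (G (T x))%:E)%E.

(** Both terms are finite since [2 <= q] and [p <= q]; comparisons of energies thereby become real
    inequalities, in which terms can be cancelled. *)
Lemma energyE L T : Lq mu D q L -> Lq nu B q T ->
  energy L T = (\int[mu]_(z in D) (L z ^+ 2) +
                2 / p * \int[nu]_(x in B) G (T x))%:E.
Proof.
move=> LL TL; rewrite /energy EFinD; congr (_ + _)%E; rewrite /Rintegral.
  rewrite fineK//; apply: integrable_fin_num => //.
  exact: Lq_integrable_sqr LL.
rewrite [RHS]EFinM fineK//; apply: integrable_fin_num => //.
exact: integrable_boundary_energy.
Qed.

Lemma Lq_addZ d (X : measurableType d) (m : {measure set X -> \bar R})
  (E : set X) (mE : measurable E) (finE : (m E < +oo)%E)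
  (f h : X -> R) (M t : R) :
  Lq m E q f -> measurable_fun E h -> (forall x, E x -> `|h x| <= M) ->
  Lq m E q (fun x => f x + t * h x).
Proof.
move=> fL mh hM; apply: (LqD mE q0 fL).
apply: (@Lq_bounded _ _ _ _ _ mE finE _ (`|t| * M)) => //.
  exact: measurable_funM.
by move=> x Ex; rewrite normrM ler_wpM2l// hM.
Qed.

Variables (L psi : T1 -> R) (T phi : T2 -> R) (M : R).
Hypotheses (LL : Lq mu D q L) (TL : Lq nu B q T).
Hypotheses (mpsi : measurable_fun D psi)
  (psiM : forall x, D x -> `|psi x| <= M).
Hypotheses (mphi : measurable_fun B phi)
  (phiM : forall x, B x -> `|phi x| <= M).

Lemma variation_le (t : R) : 0 < t ->
  (energy L T <= energy (fun z => (L z + t * psi z)%R)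
                        (fun x => (T x + t * phi x)%R))%E ->
  \int[nu]_(x in B) (g (T x + t * phi x) * phi x) <=
  \int[mu]_(z in D) (L z * psi z) + t / 2 * \int[mu]_(z in D) (psi z ^+ 2).
Proof.
move=> t0.
have LtL := Lq_addZ mD finD t LL mpsi psiM.
have TtL := Lq_addZ mB finB t TL mphi phiM.
rewrite !energyE// lee_fin.
have psiL : Lq mu D q psi by exact: Lq_bounded psiM.
have iL2 := Lq_integrable_sqr mD finD q2 LL.
have ipsi2 := Lq_integrable_sqr mD finD q2 psiL.
have iLpsi := integrable_Lq_bounded mD finD q1 LL mpsi psiM.
have igphi := integrable_boundary_force TtL mphi phiM.
have iG := integrable_boundary_energy TL.
have iGt := integrable_boundary_energy TtL.
have -> : \int[mu]_(z in D) ((L z + t * psi z) ^+ 2) =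
    \int[mu]_(z in D) (L z ^+ 2) + (2 * t * \int[mu]_(z in D) (L z * psi z) +
    t ^+ 2 * \int[mu]_(z in D) (psi z ^+ 2)).
  have i1 := integrableZl mD (2 * t) iLpsi.
  have i2 := integrableZl mD (t ^+ 2) ipsi2.
  have i12 : mu.-integrable D (EFin \o
      (fun z => 2 * t * (L z * psi z) + t ^+ 2 * psi z ^+ 2)).
    exact: (integrableD mD i1 i2).
  rewrite -(RintegralZl (2 * t) mD iLpsi) -(RintegralZl (t ^+ 2) mD ipsi2).
  rewrite -(RintegralD mD i1 i2) -(RintegralD mD iL2 i12).
  by apply: eq_Rintegral => z _; ring.
(* The tangent is taken at the displaced trace: the one at [T] would bound the increment of [G] from
   below, whereas an upper bound is required. *)
have : \int[nu]_(x in B) G (T x + t * phi x) +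
    p * t * \int[nu]_(x in B) (g (T x + t * phi x) * phi x) <=
    \int[nu]_(x in B) G (T x).
  have i1 := integrableZl mB (p * t) igphi.
  rewrite -(RintegralZl (p * t) mB igphi) -(RintegralD mB iGt i1).
  apply: le_Rintegral => //; first exact: (integrableD mB iGt i1).
  move=> x Bx.
  have := boundary_energy_tangent lneg0 lpos0 p1 (T x + t * phi x) (T x).
  by apply: le_trans; rewrite le_eqVlt; apply/orP; left; apply/eqP; ring.
set a := \int[nu]_(x in B) G (T x); set b := \int[nu]_(x in B) G (T x + _).
set c := \int[nu]_(x in B) _; set e := \int[mu]_(x in D) (L x * _).
set f := \int[mu]_(x in D) (psi x ^+ 2).
move=> h1; rewrite -addrA lerD2l => h2.
have h3 : 2 / p * b + 2 * t * c <= 2 / p * a.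
  have := ler_wpM2l (ltW (divr_gt0 (ltr0Sn _ 1) p0) : 0 <= 2 / p) h1.
  suff -> : 2 / p * (b + p * t * c) = 2 / p * b + 2 * t * c by [].
  by field; rewrite gt_eqF.
have t20 : 0 < 2 * t by rewrite mulr_gt0.
rewrite -(ler_pM2l t20).
by rewrite mulrDr (_ : 2 * t * (t / 2 * f) = t ^+ 2 * f); [lra|field].
Qed.

Lemma first_variation_le :
  (forall t : R, 0 < t ->
    (energy L T <= energy (fun z => (L z + t * psi z)%R)
                          (fun x => (T x + t * phi x)%R))%E) ->
  \int[nu]_(x in B) (g (T x) * phi x) <= \int[mu]_(z in D) (L z * psi z).
Proof.
move=> hmin; pose t (k : nat) : R := k.+1%:R^-1.
have t0 k : 0 < t k by rewrite invr_gt0.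
have tcvg : t k @[k --> \oo] --> (0 : R) by exact: cvg_harmonic.
have t1 k : t k <= 1 by rewrite invf_le1// ler1n.
set c := \int[mu]_(z in D) (L z * psi z).
set e := \int[mu]_(z in D) (psi z ^+ 2).
have ub : (fun k => c + t k / 2 * e) @ \oo --> c.
  rewrite -[X in _ --> X]addr0; apply: cvgD; first exact: cvg_cst.
  rewrite -(mul0r e); apply: cvgMr_tmp; rewrite -(mul0r 2^-1); exact: cvgMr_tmp.
(* If [B] is empty, [M] may be negative, so its sign is only claimed at points of [B]. *)
have M0 x : B x -> 0 <= M.
  by move=> Bx; rewrite (le_trans (normr_ge0 (phi x)))// phiM.
(* Since [t k <= 1], this function dominates all the displaced traces, and its power [p - 1 <= q]
   gives the integrable bound for dominated convergence. The factor 1 matches the shape of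
   [Lq_addZ]. *)
have TL' : Lq nu B q (fun x => `|T x| + 1 * M).
  have TLn : Lq nu B q (fun x => `|T x|).
    have [mT foo] := TL; split; first exact: measurableT_comp.
    by under eq_integral do rewrite normr_id.
  exact: (Lq_addZ mB finB 1 TLn (measurable_cst M) (fun x _ => lexx `|M|)).
have lhs : (\int[nu]_(x in B) (g (T x + t k * phi x) * phi x)%:E)%E @[k --> \oo]
    --> (\int[nu]_(x in B) (g (T x) * phi x)%:E)%E.
  apply: (@dominated_cvg _ _ _ nu B mB _ _
    (fun x => ((lneg + lpos) * M * `| `|T x| + 1 * M| `^ (p - 1))%:E)).
  - move=> k; apply/measurable_EFinP; apply: measurable_funM => //.
    apply: (measurableT_comp measurable_boundary_force).
    by have [] := Lq_addZ mB finB (t k) TL mphi phiM.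
  - move=> x Bx; apply: cvg_EFin; first by near=> k.
    have Tk : (T x + t k * phi x) @[k --> \oo] --> T x.
      rewrite -[X in _ --> X]addr0; apply: cvgD; first exact: cvg_cst.
      by rewrite -(mul0r (phi x)); exact: cvgMr_tmp.
    have gc : {for T x, continuous g} by exact: continuous_boundary_force.
    exact: cvgMr_tmp (continuous_cvg _ gc Tk).
  - by [].
  - have := @integrableZl _ _ _ nu B mB ((lneg + lpos) * M)
      (EFin \o (fun x => `| `|T x| + 1 * M| `^ (p - 1))).
    apply; apply: (Lq_integrable_le mB finB _ _ TL').
      by rewrite subr_ge0 ltW.
    by rewrite lerBlDr (le_trans pq)// lerDl.
  - move=> k x Bx; rewrite abse_EFin lee_fin normrM mulrAC ler_pM ?phiM//.
    apply: (le_trans (boundary_force_le lneg0 lpos0 p1 _)).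
    rewrite ler_wpM2l ?addr_ge0//; apply: ge0_ler_powR; rewrite ?nnegrE//.
      by rewrite subr_ge0 ltW.
    rewrite mul1r [leRHS]ger0_norm ?addr_ge0 ?(M0 x)//.
    rewrite (le_trans (ler_normD _ _))// lerD2l.
    rewrite normrM ger0_norm ?(ltW (t0 k))//.
    by rewrite -[M]mul1r ler_pM// ?(ltW (t0 k))// phiM.
have lhsR : \int[nu]_(x in B) (g (T x + t k * phi x) * phi x) @[k --> \oo]
    --> \int[nu]_(x in B) (g (T x) * phi x).
  apply: fine_cvg; rewrite fineK//.
  apply: integrable_fin_num => //.
  exact: (integrable_boundary_force TL mphi phiM).
apply: (ler_cvg_to lhsR ub); near=> k.
exact: (variation_le (t0 k) (hmin (t k) (t0 k))).
Unshelve. all: by end_near. Qed.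

End first_variation.

(** * Borel measurability and translation invariance of the Lebesgue measure *)

Section open_measurable.
Context (R : realType) (n : nat).

Lemma rV_ballE (x : 'rV[R]_n) (e : R) : 0 < e ->
  ball x e = [set y | forall i, ball (x ord0 i) e (y ord0 i)].
Proof.
move=> e0; apply/seteqP; split => y /=; first by case=> _ h i; exact: h.
by move=> h; split=> // i j; rewrite (ord1 i); exact: h.
Qed.

Lemma measurable_rV_cylinder (A : 'I_n -> set (measurableTypeR R)) :
  (forall i, measurable (A i)) ->
  measurable [set x : 'rV[R]_n | forall i, A i (x ord0 i)].
Proof.
move=> mA.
rewrite (_ : [set x | _] = \big[setI/setT]_(i < n)
    (@rV_coord R n i @^-1` A i)).
  apply: bigsetI_measurable => i _; rewrite -[X in measurable X]setTI.
  exact: measurable_rV_coord.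
apply/seteqP; split => y; rewrite -bigcap_seq /=.
  by move=> h i _; exact: h.
by move=> h i; apply: h; rewrite /= mem_index_enum.
Qed.

Lemma measurable_rV_ball (x : 'rV[R]_n) (e : R) : measurable (ball x e).
Proof.
have [e0|e0] := ltP 0 e.
  rewrite rV_ballE//.
  apply: (@measurable_rV_cylinder (fun i => (ball (x ord0 i) e : set R))) => i.
  exact: measurable_ball.
rewrite (_ : ball x e = set0)//; apply/seteqP; split => // y [].
by rewrite ltNge e0.
Qed.

Let ratball (t : 'rV[rat]_n * rat * nat) : set ('rV[R]_n * R) :=
  ball ((map_mx ratr t.1.1, ratr t.1.2) : 'rV[R]_n * R) t.2.+1%:R^-1.

Let measurable_ratball t :
  measurable (ratball t : set ('rV[R]_n * measurableTypeR R)).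
Proof.
rewrite (_ : ratball t = ball (map_mx ratr t.1.1 : 'rV[R]_n) t.2.+1%:R^-1 `*`
   ball (ratr t.1.2 : R) t.2.+1%:R^-1)//.
by apply: measurableX; [exact: measurable_rV_ball|exact: measurable_ball].
Qed.

(** Balls of the sup norm are boxes, hence measurable, and an open set is the union of the countably
    many balls with rational centre and radius [1 / (k + 1)] that it contains. *)
Lemma open_measurable_E (O : set ('rV[R]_n * R)) : open O ->
  measurable (O : set ('rV[R]_n * measurableTypeR R)).
Proof.
move=> oO.
rewrite (_ : O = \bigcup_t
    (if `[< ratball t `<=` O >] then ratball t else set0)).
  apply: countable_bigcupT_measurable; first exact: countableP.
  by move=> t; case: ifPn => // _; exact: measurable_ratball.
apply/seteqP; split => [z Oz|z [t _]]; last by case: asboolP => // tO /tO.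
have [e /= e0 zO] : exists2 e : R, 0 < e & ball z e `<=` O.
  by have /nbhs_ballP := oO _ Oz.
(* Chosen so that [2 d <= e]: a ball of radius [d] whose centre is within [d] of [z] then lies in
   [ball z e]. *)
pose k := Num.truncn (2 / e); pose d : R := k.+1%:R^-1.
have d0 : 0 < d by rewrite invr_gt0.
have d2e : d + d <= e.
  rewrite -mulr2n -mulr_natl ler_pdivrMr// mulrC -ler_pdivrMr// ltW//.
  exact: truncnS_gt.
have rat_near (y : R) : {r : rat | ball y d (ratr r)}.
  apply/cid; have /rat_in_itvoo[r] : y - d < y + d by rewrite ltrD2l gtrN.
  by rewrite in_itv /= => ?; exists r; rewrite ball_itv /= in_itv.
pose c : 'rV[rat]_n * rat :=
  (\row_i sval (rat_near (z.1 ord0 i)), sval (rat_near z.2)).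
have zc : ratball (c, k) z.
  split => /=; last exact/ball_sym/(svalP (rat_near _)).
  rewrite rV_ballE// => i /=; rewrite !mxE; exact/ball_sym/(svalP (rat_near _)).
exists (c, k) => //; rewrite asboolT// => w cw; apply: zO.
by apply: (le_ball d2e); apply: ball_triangle cw; exact: ball_sym.
Qed.

Lemma continuous_measurable_E (O : set ('rV[R]_n * R)) (f : 'rV[R]_n * R -> R) :
  open O -> (forall z, O z -> {for z, continuous f}) ->
  measurable_fun (O : set ('rV[R]_n * measurableTypeR R)) f.
Proof.
move=> oO cf; apply: (measurability _ (RGenOpens.measurableE R)).
move=> _ [_ [a [b ->] <-]]; apply: open_measurable_E.
rewrite openE => z [Oz fz]; apply: filterI; first exact: open_nbhs_nbhs.
by apply: (cf z Oz); apply: open_nbhs_nbhs; split => //; exact: interval_open.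
Qed.

(** Reduced to the product space: [O] is the preimage of the cylinder over [O] under [x |-> (x, 0)],
    and [f] factors through this map and [fst]. *)
Lemma continuous_measurable_rV (O : set 'rV[R]_n) (f : 'rV[R]_n -> R) :
  open O -> (forall x, O x -> {for x, continuous f}) ->
  measurable O /\ measurable_fun O f.
Proof.
move=> oO cf.
have mi : measurable_fun [set: 'rV[R]_n]
    (fun x => (x, 0) : 'rV[R]_n * measurableTypeR R).
  by apply: measurable_fun_pair.
pose O' : set ('rV[R]_n * measurableTypeR R) := O `*` [set: R].
have oO' : open (O' : set ('rV[R]_n * R)).
  rewrite (_ : O' = fst @^-1` O).
    by apply: open_comp => // z _; exact: cvg_fst.
  by apply/seteqP; split => z //=; case.
have mO' := open_measurable_E oO'.
have mO : measurable O.
  rewrite (_ : O = setT `&` (fun x => (x, 0)) @^-1` O'); first exact: mi.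
  by apply/seteqP; split => x; [move=> Ox|case=> _ []].
split=> //.
have mf : measurable_fun O' (f \o fst).
  apply: (continuous_measurable_E oO') => -[x y] [/= Ox _].
  apply: (@continuous_comp _ _ _ fst f); first exact: cvg_fst.
  exact: cf.
apply: (@measurable_comp _ _ _ _ _ _ O' (f \o fst) O (fun x => (x, 0))) => //.
  by move=> _ [x Ox <-]; split.
exact: measurable_funS mi.
Qed.

End open_measurable.

Section translation.
Context (R : realType).

Lemma measurable_addr (a : R) :
  measurable_fun [set: measurableTypeR R]
    ((fun x => x + a) : measurableTypeR R -> measurableTypeR R).
Proof. exact: measurable_funD. Qed.

(** The push-forward under the translation agrees with Lebesgue measure on half-open intervals,
    which characterise it. The product case below argues in the same way with measurable
    rectangles. *)
Lemma lebesgue_measure_translation (a : R) (A : set (measurableTypeR R)) :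
  measurable A ->
  lebesgue_measure ((fun x => x + a) @^-1` A) = lebesgue_measure A.
Proof.
move=> mA; apply/esym.
pose mu := measure_function_pushforward__canonical__measure_function_Measure
  (@lebesgue_measure R) (measurable_addr a).
apply: (@lebesgue_measure_unique R mu) => // _ [[x y] _ <-].
rewrite /mu /= /pushforward.
rewrite (_ : _ @^-1` _ = `]x - a, y - a]%classic); last first.
  by apply/seteqP; split => t /=; rewrite !in_itv /= ltrBlDr lerBrDr.
rewrite !lebesgue_measure_itv /= !lte_fin ltrD2r.
by case: ifPn => // _; rewrite -!EFinB; congr EFin; ring.
Qed.

Lemma measurable_addr_rV n (a : 'rV[R]_n) :
  measurable_fun [set: 'rV[R]_n] (fun x : 'rV[R]_n => x + a).
Proof.
apply: measurable_fun_rV_coord => i.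
rewrite (_ : _ \o _ = fun x => @rV_coord R n i x + a ord0 i).
  by apply: measurable_funD => //; exact: measurable_rV_coord.
by apply/funext => x; rewrite /rV_coord /= mxE.
Qed.

Lemma product_measure_translation d1 (T1 : measurableType d1)
  d2 (T2 : measurableType d2) (m1 : {sigma_finite_measure set T1 -> \bar R})
  (m2 : {sigma_finite_measure set T2 -> \bar R}) (f : T1 -> T1) (g : T2 -> T2) :
  measurable_fun setT f -> measurable_fun setT g ->
  (forall A, measurable A -> m1 (f @^-1` A) = m1 A) ->
  (forall A, measurable A -> m2 (g @^-1` A) = m2 A) ->
  forall A, measurable A ->
    (m1 \x m2)%E ((fun z => (f z.1, g z.2)) @^-1` A) = (m1 \x m2)%E A.
Proof.
move=> mf mg hf hg A mA; apply/esym.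
have mfg : measurable_fun [set: (T1 * T2)%type] (fun z => (f z.1, g z.2)).
  apply: measurable_fun_pair.
    exact: measurableT_comp mf measurable_fst.
  exact: measurableT_comp mg measurable_snd.
pose mu := measure_function_pushforward__canonical__measure_function_Measure
  (m1 \x m2)%E mfg.
apply: (@product_measure_unique _ _ _ _ _ m1 m2 mu) => // B C mB mC.
rewrite /mu /= /pushforward.
rewrite (_ : _ @^-1` _ = (f @^-1` B) `*` (g @^-1` C))//.
have mfB : measurable (f @^-1` B).
  by rewrite -[X in measurable X]setTI; exact: mf.
have mgC : measurable (g @^-1` C).
  by rewrite -[X in measurable X]setTI; exact: mg.
by rewrite product_measure1E//; congr (_ * _)%E; [exact: hf|exact: hg].
Qed.

Lemma lebesgue_rV_translation n (a : 'rV[R]_n) (A : set 'rV[R]_n) :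
  measurable A ->
  lebesgue_rV R n ((fun x => x + a) @^-1` A) = lebesgue_rV R n A.
Proof.
elim: n a A => [|n IHn] a A mA.
  suff -> : (fun x : 'rV[R]_0 => x + a) = id by [].
  by apply/funext => x; apply/rowP; case.
pose a' : 'rV[R]_n := \row_j a ord0 (lift ord0 j).
have mcA : measurable (@consrV R n @^-1` A).
  by rewrite -[X in measurable X]setTI; exact: measurable_consrV.
have h := product_measure_translation (measurable_addr (a ord0 ord0))
  (measurable_addr_rV a') (@lebesgue_measure_translation _) (IHn a') mcA.
(* [consrV] conjugates the translation by [a] to a product of translations, to which the induction
   hypothesis applies. *)
have ef : (fun x => x + a) \o @consrV R n =
    @consrV R n \o (fun z => (z.1 + a ord0 ord0, z.2 + a')).
  apply/funext => -[t x] /=; apply/rowP => i; rewrite !mxE.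
  by case: unliftP => [j ->|->]; rewrite ?mxE.
transitivity ((@lebesgue_measure R \x lebesgue_rV R n)%E
    (((fun x => x + a) \o @consrV R n) @^-1` A)).
  by [].
rewrite ef.
exact: h.
Qed.

End translation.

(** * Translations and boxes in the product space; finiteness and compactness of the half ball *)

Section half_space_measure.
Context (R : realType) (n : nat).
Local Notation E := ('rV[R]_n * R)%type.
Local Notation mE := ('rV[R]_n * measurableTypeR R)%type.
Local Notation mu := (lebesgue_E R n).
Local Notation HB := (@half_ball R n).
Local Notation UB := (@unit_ball R n).

Definition shift_E (a z : mE) : mE := (z.1 + a.1, z.2 + a.2).

Lemma measurable_shift_E (a : mE) : measurable_fun setT (shift_E a).
Proof.
apply: measurable_fun_pair.
  exact: measurableT_comp (measurable_addr_rV a.1) measurable_fst.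
exact: measurableT_comp (measurable_addr a.2) measurable_snd.
Qed.

Lemma lebesgue_E_translation (a : mE) (A : set mE) : measurable A ->
  mu (shift_E a @^-1` A) = mu A.
Proof.
move=> mA.
exact: (product_measure_translation
  (measurable_addr_rV a.1) (measurable_addr a.2)
  (@lebesgue_rV_translation R n a.1) (@lebesgue_measure_translation R a.2) mA).
Qed.

Lemma integral_translation (a : mE) (f : mE -> \bar R) :
  measurable_fun setT f ->
  mu.-integrable setT (f \o shift_E a) ->
  (\int[mu]_z f (shift_E a z) = \int[mu]_z f z)%E.
Proof.
move=> mf fi.
rewrite -[LHS](integral_pushforward (measurable_shift_E a) mf fi measurableT).
apply: eq_measure_integral; first exact: measurable_shift_E.
by move=> ms A mA _; exact: lebesgue_E_translation.
Qed.

(** Boxes serve as bounded reference sets because [lebesgue_rV_box] computes their measure, which is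
    thus finite. *)
Definition box_rV (r : R) : set 'rV[R]_n :=
  [set x | forall i, `[-r, r]%classic (x ord0 i)].

Definition box_E (r : R) : set mE :=
  box_rV r `*` (`[-r, r]%classic : set (measurableTypeR R)).

Lemma measurable_box_rV r : measurable (box_rV r).
Proof.
apply: (@measurable_rV_cylinder R n (fun=> `[-r, r]%classic)) => i.
exact: measurable_itv.
Qed.

Lemma measurable_box_E r : measurable (box_E r).
Proof.
by apply: measurableX; [exact: measurable_box_rV|exact: measurable_itv].
Qed.

Let itv_fin_num (r : R) :
  lebesgue_measure (`[-r, r]%classic : set (measurableTypeR R)) \is a fin_num.
Proof.
have := @lebesgue_measure_itv R `[-r, r].
by rewrite /= => ->; case: ifPn.
Qed.

Let box_rV_fin_num r : lebesgue_rV R n (box_rV r) \is a fin_num.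
Proof.
rewrite (@lebesgue_rV_box R n (fun=> `[-r, r]%classic)); last first.
  by move=> i; exact: measurable_itv.
apply: (@big_ind _ (fun x => x \is a fin_num)) => // x y xf yf.
by rewrite fin_numM.
Qed.

Lemma box_rV_lty r : (lebesgue_rV R n (box_rV r) < +oo)%E.
Proof. by rewrite ltey_eq box_rV_fin_num. Qed.

Lemma box_E_lty r : (mu (box_E r) < +oo)%E.
Proof.
have mb := measurable_box_rV r.
have mi : measurable (`[-r, r]%classic : set (measurableTypeR R)).
  exact: measurable_itv.
rewrite ltey_eq /lebesgue_E /= /box_E product_measure1E//.
by rewrite fin_numM// ?itv_fin_num// box_rV_fin_num.
Qed.

Lemma sqnorm_ge0 (x : 'rV[R]_n) : 0 <= sqnorm x.
Proof. by apply: sumr_ge0 => i _; exact: sqr_ge0. Qed.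

Lemma sqnorm_coord (x : 'rV[R]_n) i : x ord0 i ^+ 2 <= sqnorm x.
Proof.
by rewrite /sqnorm (bigD1 i)//= lerDl sumr_ge0// => j _; exact: sqr_ge0.
Qed.

Lemma continuous_sqnorm : continuous (@sqnorm R n).
Proof.
apply: continuous_big => [|i _].
  by move=> z; exact: add_continuous.
move=> x.
apply: (@cvg_comp _ _ _ (fun x : 'rV[R]_n => x ord0 i) (fun t => t ^+ 2)).
  exact: coord_continuous.
exact: exprn_continuous.
Qed.

Let itvN11 (t : R) : t ^+ 2 <= 1 -> `[-1, 1]%classic t.
Proof.
move=> h; rewrite /= in_itv /= -ler_norml -(@expr_le1 _ 2)//.
by rewrite real_normK// num_real.
Qed.

Lemma unit_ball_box : UB `<=` box_rV 1.
Proof.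
move=> x /ltW x1 i; apply: itvN11; exact: le_trans (sqnorm_coord x i) x1.
Qed.

Lemma closed_ball_box (z : E) : sqnorm z.1 + z.2 ^+ 2 <= 1 -> box_E 1 z.
Proof.
move=> z1; split.
  move=> i; apply: itvN11; apply: le_trans z1.
  by rewrite (le_trans (sqnorm_coord _ i))// lerDl sqr_ge0.
by apply: itvN11; apply: le_trans z1; rewrite lerDr sqnorm_ge0.
Qed.

Lemma half_ball_box : HB `<=` box_E 1.
Proof. by move=> z [z1 _]; apply: closed_ball_box; exact: ltW. Qed.

Lemma continuous_sqnormE : continuous (fun z : E => sqnorm z.1 + z.2 ^+ 2).
Proof.
move=> z; apply: cvgD.
  apply: (@cvg_comp _ _ _ fst (@sqnorm R n)); first exact: cvg_fst.
  exact: continuous_sqnorm.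
apply: (@cvg_comp _ _ _ snd (fun t : R => t ^+ 2)); first exact: cvg_snd.
exact: exprn_continuous.
Qed.

Lemma open_unit_ball : open UB.
Proof.
rewrite (_ : UB = @sqnorm R n @^-1` [set t | t < 1])//.
by apply: open_comp; [move=> x _; exact: continuous_sqnorm|exact: open_lt].
Qed.

Lemma open_half_ball : open HB.
Proof.
rewrite (_ : HB =
   (fun z : E => sqnorm z.1 + z.2 ^+ 2) @^-1` [set t | t < 1] `&`
   snd @^-1` [set t : R | 0 < t])//.
apply: openI; apply: open_comp.
- by move=> x _; exact: continuous_sqnormE.
- exact: open_lt.
- by move=> x _; exact: cvg_snd.
- exact: open_gt.
Qed.

Lemma measurable_half_ball : measurable (HB : set mE).
Proof. exact: (open_measurable_E open_half_ball). Qed.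

Lemma half_ball_lty : (mu HB < +oo)%E.
Proof.
apply: le_lt_trans (box_E_lty 1); apply: le_measure.
- by rewrite inE; exact: measurable_half_ball.
- by rewrite inE; exact: measurable_box_E.
- exact: half_ball_box.
Qed.

Lemma measurable_unit_ball : measurable UB.
Proof.
have cst0 : forall x : 'rV[R]_n, UB x -> {for x, continuous (cst (0 : R))}.
  by move=> x _; exact: cst_continuous.
exact: (proj1 (continuous_measurable_rV open_unit_ball cst0)).
Qed.

Lemma unit_ball_lty : (lebesgue_rV R n UB < +oo)%E.
Proof.
apply: le_lt_trans (box_rV_lty 1); apply: le_measure.
- by rewrite inE; exact: measurable_unit_ball.
- by rewrite inE; exact: measurable_box_rV.
- exact: unit_ball_box.
Qed.

(** This is what makes a function smooth up to the boundary bounded on the half ball together with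
    all its derivatives. *)
Lemma compact_closure_half_ball : compact (closure HB).
Proof.
have cb : compact (box_E 1 : set E).
  apply: compact_setX; last exact: segment_compact.
  have h (i : 'I_n) : compact (`[-1, 1]%classic : set R).
    exact: segment_compact.
  exact: (rV_compact h).
apply: (subclosed_compact _ cb); first exact: closed_closure.
have cl : closed [set z : E | sqnorm z.1 + z.2 ^+ 2 <= 1].
  rewrite (_ : [set z | _] =
     (fun z : E => sqnorm z.1 + z.2 ^+ 2) @^-1` [set t | t <= 1])//.
  apply: closed_comp; last exact: closed_le.
  by move=> z _; exact: continuous_sqnormE.
move=> z cz; apply: closed_ball_box.
change ([set z : E | sqnorm z.1 + z.2 ^+ 2 <= 1] z).
rewrite (iffLR (closure_id _) cl); apply: closureS cz => w [w1 _] /=.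
exact: ltW.
Qed.

Lemma flat_boundary_closure (z : E) : flat_boundary z -> closure HB z.
Proof.
case: z => x y [/= + y0]; rewrite y0 expr0n addr0 => x1.
move=> B /nbhs_ballP[e /= e0 eB].
(* A height below [e], to stay in the neighbourhood, whose square is at most half of the gap to the
   unit sphere, to stay in the half ball. *)
pose t := Num.min (e / 2) (Num.sqrt ((1 - sqnorm x) / 2)).
have s0 : 0 < (1 - sqnorm x) / 2 by rewrite divr_gt0// subr_gt0.
have t0 : 0 < t by rewrite lt_min divr_gt0//= sqrtr_gt0.
have te : t < e by rewrite gt_min ltr_pdivrMr// ltr_pMr// ltrDl ltr01.
have t2 : t ^+ 2 <= (1 - sqnorm x) / 2.
  rewrite -[leRHS](sqr_sqrtr (ltW s0)) ler_sqr ?nnegrE ?sqrtr_ge0 ?(ltW t0)//.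
  by rewrite ge_min lexx orbT.
exists (x, t); split; first by split => //=; lra.
apply: eB; split; first exact: ballxx.
by rewrite /ball /= sub0r normrN gtr0_norm.
Qed.

End half_space_measure.

(** * Partial derivatives and integration by parts *)

Section partial_derivatives.
Context (R : realType) (n : nat).
Local Notation E := ('rV[R]_n * R)%type.
Local Notation HB := (@half_ball R n).
Implicit Types (f g eta : E -> R) (U : set E) (s : seq (option 'I_n)).

Lemma pderiv_cat s1 s2 f : pderiv s1 (pderiv s2 f) = pderiv (s1 ++ s2) f.
Proof. by elim: s1 => //= i s1 ->. Qed.

Lemma open_near U z (P : E -> Prop) : open U -> U z -> (forall w, U w -> P w) ->
  \forall w \near z, P w.
Proof. by move=> oU Uz UP; apply: filterS UP _; exact: open_nbhs_nbhs. Qed.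

Lemma eq_pderiv U s f g : open U -> (forall z, U z -> f z = g z) ->
  forall z, U z -> pderiv s f z = pderiv s g z.
Proof.
move=> oU fg; elim: s => //= i s IHs z Uz.
by apply: near_eq_derive; exact: open_near oU Uz IHs.
Qed.

Lemma smooth_on_pderiv U s f : smooth_on U f -> smooth_on U (pderiv s f).
Proof. by move=> fS s' z Uz; rewrite pderiv_cat; exact: fS. Qed.

Lemma continuous_near_eq f g (z : E) : (\forall w \near z, f w = g w) ->
  {for z, continuous f} -> {for z, continuous g}.
Proof.
move=> fg cf; rewrite /prop_for /continuous_at -(nbhs_singleton fg).
exact: cvg_trans (near_eq_cvg fg) cf.
Qed.

Lemma eq_smooth_on U f g : open U -> (forall z, U z -> f z = g z) ->
  smooth_on U f -> smooth_on U g.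
Proof.
move=> oU fg fS s z Uz; have [cf df] := fS s z Uz.
have near_fg := open_near oU Uz (eq_pderiv s oU fg).
split; first exact: continuous_near_eq cf.
by move=> i; exact: near_eq_derivable (df i).
Qed.

Lemma pderiv_addZ U s f g (t : R) : open U -> smooth_on U f -> smooth_on U g ->
  forall z, U z ->
  pderiv s (fun w => f w + t * g w) z = pderiv s f z + t * pderiv s g z.
Proof.
move=> oU fS gS; elim: s => //= i s IHs z Uz.
rewrite (near_eq_derive _ (open_near oU Uz IHs)).
have [_ /(_ i) df] := fS s z Uz; have [_ /(_ i) dg] := gS s z Uz.
have dtg := derivableZ (k := t) dg.
rewrite [LHS](@deriveD _ _ _ (pderiv s f) (t *: pderiv s g) _ _ df dtg).
by rewrite (deriveZ t dg).
Qed.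

Lemma smooth_on_addZ U f g (t : R) : open U -> smooth_on U f -> smooth_on U g ->
  smooth_on U (fun w => f w + t * g w).
Proof.
move=> oU fS gS s z Uz; have [cf df] := fS s z Uz; have [cg dg] := gS s z Uz.
have eq_near : \forall w \near z, pderiv s f w + t * pderiv s g w =
    pderiv s (fun w => f w + t * g w) w.
  by apply: (open_near oU Uz) => w Uw; rewrite (pderiv_addZ s t oU).
split=> [|i].
  apply: (continuous_near_eq eq_near); apply: cvgD; first exact: cf.
  by apply: cvgM; [exact: cvg_cst|exact: cg].
apply: (near_eq_derivable eq_near).
have dtg := derivableZ (k := t) (dg i).
exact: (@derivableD _ _ _ (pderiv s f) (t *: pderiv s g) _ _ (df i) dtg).
Qed.

Lemma smooth_upto_addZ U f g (t : R) : open U ->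
  smooth_upto U f -> smooth_upto U g ->
  smooth_upto U (fun w => f w + t * g w).
Proof.
move=> oU [fS fc fe] [gS gc ge]; split.
- exact: smooth_on_addZ.
- move=> z; apply: cvgD; first exact: fc.
  by apply: cvgM; [exact: cvg_cst|exact: gc].
- move=> s; have [h [hc hE]] := fe s; have [k [kc kE]] := ge s.
  exists (fun w => h w + t * k w); split.
    move=> z; apply: cvgD; first exact: hc.
    by apply: cvgM; [exact: cvg_cst|exact: kc].
  by move=> z Uz; rewrite hE// kE// (pderiv_addZ s t oU).
Qed.

(* [pderiv s f] itself need not be smooth up to the boundary: its values there
   depend on [f] outside of [closure U]. *)
Lemma smooth_upto_pderiv U f s : open U -> smooth_upto U f ->
  exists2 h, smooth_upto U h & forall z, U z -> h z = pderiv s f z.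
Proof.
move=> oU [fS fc fe]; have [h [hc hE]] := fe s.
exists h; last exact: hE.
split; [|exact: hc|].
  apply: (@eq_smooth_on U (pderiv s f) h oU _ (smooth_on_pderiv s fS)).
  by move=> z /hE ->.
move=> s'; have [k [kc kE]] := fe (s' ++ s).
exists k; split => // z Uz; rewrite kE// -pderiv_cat.
by apply/esym/(eq_pderiv s' oU).
Qed.

Lemma compact_continuous_bounded (K : set E) f : compact K ->
  {within K, continuous f} -> exists M, forall z, K z -> `|f z| <= M.
Proof.
move=> cK fc; have := compact_bounded (continuous_compact fc cK).
move=> [M [_ hM]]; exists (M + 1) => z Kz.
by apply: (hM (M + 1)); [rewrite ltrDl|exists z].
Qed.

(** For open [U] this depends only on the values of [f] in [U], so that, unlike [smooth_upto], it
    passes from [f] to [pderiv s f] itself. *)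
Definition smooth_bounded U f :=
  smooth_on U f /\ forall s, exists M, forall z, U z -> `|pderiv s f z| <= M.

Lemma smooth_bounded_pderiv U s f : smooth_bounded U f ->
  smooth_bounded U (pderiv s f).
Proof.
move=> [fS fb]; split; first exact: smooth_on_pderiv.
by move=> s'; rewrite pderiv_cat; exact: fb.
Qed.

Lemma smooth_upto_bounded U f : compact (closure U) -> smooth_upto U f ->
  smooth_bounded U f.
Proof.
move=> cU [fS _ fe]; split => // s; have [h [hc hE]] := fe s.
have [M hM] := compact_continuous_bounded cU hc.
by exists M => z Uz; rewrite -hE// hM//; exact: subset_closure.
Qed.

(** The complement of a compact set is open, so derivatives vanish off [K] too. The equation is
    oriented for rewriting a derivative of [f] into that of a constant. *)
Lemma compl_near (K : set E) f z : compact K -> (forall z, ~ K z -> f z = 0) ->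
  ~ K z -> \forall w \near z, 0 = f w.
Proof.
move=> cK fK Kz; have oK : open (~` K).
  by apply: closed_openC; apply: compact_closed => //; exact: norm_hausdorff.
by apply: (open_near oK Kz) => w Kw; rewrite fK.
Qed.

Lemma test_fun_pderiv U s eta : test_fun U eta -> test_fun U (pderiv s eta).
Proof.
move=> [eS [K [cK KU eK]]]; split; first exact: smooth_on_pderiv.
exists K; split => //; elim: s => //= i s IHs z Kz.
by rewrite -(near_eq_derive _ (compl_near cK IHs Kz)) derive_cst.
Qed.

Lemma test_fun_bounded U eta : test_fun U eta ->
  exists M, forall z, `|eta z| <= M.
Proof.
move=> [eS [K [cK KU eK]]].
have [|M hM] := compact_continuous_bounded cK (f := eta).
  apply: continuous_subspaceT => z; have [h _] := eS [::] z I; exact: h.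
exists `|M| => z; have [Kz|Kz] := pselect (K z).
  by rewrite (le_trans (hM _ Kz))// ler_norm.
by rewrite eK// normr0.
Qed.

End partial_derivatives.

(** * Vanishing of the integral of a partial derivative *)

Section divergence.
Context (R : realType) (n : nat).
Local Notation E := ('rV[R]_n * R)%type.
Local Notation mE := ('rV[R]_n * measurableTypeR R)%type.
Local Notation mu := (lebesgue_E R n).
Local Notation HB := (@half_ball R n).

Lemma is_derive_line (F : E -> R) (z v : E) (s : R) :
  derivable F (z + s *: v) v ->
  is_derive s 1 (fun r : R => F (z + r *: v)) ('D_v F (z + s *: v)).
Proof.
have e : (fun h : R =>
     h^-1 *: (((fun r : R => F (z + r *: v)) \o shift s) (h *: 1)
       - F (z + s *: v))) =
   (fun h : R => h^-1 *: ((F \o shift (z + s *: v)) (h *: v) - F (z + s *: v))).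
  apply/funext => h /=; congr (_ *: (F _ - _)).
  by rewrite [h *: 1]mulr1 scalerDl addrCA.
move=> dF; split; first by rewrite /derivable e.
by rewrite /derive e.
Qed.

(** The mean value theorem along the segment from [z] to [z + h v]; it bounds the difference
    quotients uniformly in [h]. *)
Lemma increment_le (F : E -> R) (z v : E) (M h : R) :
  (forall w, derivable F w v) -> (forall w, `|'D_v F w| <= M) -> 0 < h ->
  `|F (z + h *: v) - F z| <= M * h.
Proof.
move=> dF DM h0.
have dl (s : R) :
    is_derive s 1 (fun r : R => F (z + r *: v)) ('D_v F (z + s *: v)).
  exact: is_derive_line.
have cl : {within `[0, h], continuous (fun r : R => F (z + r *: v))}.
  apply: continuous_subspaceT => s; apply: differentiable_continuous.
  by apply/derivable1_diffP; have [] := dl s.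
have [c _] := MVT_segment (ltW h0) (fun s _ => dl s) cl.
rewrite scale0r addr0 subr0 => ->.
by rewrite normrM (gtr0_norm h0) ler_wpM2r// ltW.
Qed.

(** A step of length at most 1 along a coordinate direction changes each coordinate by at most 1.
    Hence short translates of a function supported in [box_E 1] are supported in [box_E 2]. *)
Lemma dir_le1 (i : option 'I_n) (h : R) (z : E) : `|h| <= 1 ->
  box_E 1 (z + h *: dir R i) -> box_E 2 z.
Proof.
move=> h1 [b1 b2].
have le2 (a b : R) : `|b| <= 1 -> `|a + b| <= 1 -> `|a| <= 2.
  by move=> b1' ab1; rewrite -[a](addrK b) (le_trans (ler_normB _ _))// lerD.
split.
  move=> j; have := b1 j; rewrite /= !in_itv /= -!ler_norml !mxE.
  apply: le2; case: i {b1 b2} => [i|]; rewrite /= !mxE ?mulr0 ?normr0//.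
  by rewrite eqxx /=; case: eqP => _; rewrite ?mulr0 ?mulr1 ?normr0.
move: b2; rewrite /= !in_itv /= -!ler_norml.
apply: le2; case: i {b1} => [i|] /=; first by rewrite scaler0 normr0.
by rewrite [_ *: _]mulr1.
Qed.

Lemma integral_pderiv_eq0 (F : E -> R) (i : option 'I_n) (M : R) :
  (forall z, derivable F z (dir R i)) ->
  measurable_fun setT (F : mE -> R) ->
  measurable_fun setT ('D_(dir R i) F : mE -> R) ->
  (forall z, ~ box_E 1 z -> F z = 0) ->
  (forall z, `|F z| <= M) -> (forall z, `|'D_(dir R i) F z| <= M) ->
  \int[mu]_z 'D_(dir R i) F z = 0.
Proof.
move=> dF mF mDF F0 FM DM; set v := dir R i.
have M0 : 0 <= M by rewrite (le_trans (normr_ge0 (F 0))).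
(* Dominates both the translates of [F] by steps of length at most 1 and the difference quotients
   for such positive steps. *)
pose G : mE -> R := cst M \_ (box_E 2).
have iG : mu.-integrable setT (EFin \o G).
  rewrite -restrict_EFin; apply/(integrable_mkcond _ (measurable_box_E 2)).
  apply: (@integrable_bounded _ _ _ _ _ _ _ _ M) => //.
  - exact: measurable_box_E.
  - exact: box_E_lty.
  - by move=> z _; rewrite ger0_norm.
have shiftG (h : R) (z : E) : `|h| <= 1 -> ~ box_E 2 z -> F (z + h *: v) = 0.
  by move=> h1 z2; apply: F0 => /(dir_le1 h1).
have mFs (h : R) : measurable_fun setT (fun z : mE => F (z + h *: v)).
  exact: (measurableT_comp mF (measurable_shift_E (h *: v))).
have iFs (h : R) : `|h| <= 1 ->
    mu.-integrable setT (EFin \o (fun z : mE => F (z + h *: v))).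
  move=> h1.
  apply: (@integrable_dominated _ _ _ _ setT measurableT _ G) => // z _.
  rewrite /G patchE; have [z2|z2] := boolP (z \in box_E 2).
    by rewrite FM.
  by rewrite shiftG ?normr0// => /mem_set; rewrite (negbTE z2).
pose t (k : nat) : R := k.+1%:R^-1.
have t0 k : 0 < t k by rewrite invr_gt0.
have tcvg : t k @[k --> \oo] --> (0 : R) by exact: cvg_harmonic.
have t1 k : t k <= 1 by rewrite invf_le1// ler1n.
(* A directional derivative is a limit over the punctured neighbourhoods of 0. *)
have tcvg' : t @ \oo --> (0 : R)^'.
  move=> A [e /= e0 eA].
  have tA : \forall k \near \oo, ball (0 : R) e (t k).
    exact: tcvg _ (nbhsx_ballx (0 : R) e e0).
  change (\forall k \near \oo, A (t k)).
  apply: filterS tA => k kA; apply: eA => //=.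
  exact: lt0r_neq0 (t0 k).
pose Q (k : nat) (z : mE) : R := (t k)^-1 * (F (z + t k *: v) - F z).
have iF0 : mu.-integrable setT (EFin \o (F : mE -> R)).
  have := iFs 0; rewrite normr0 => /(_ ler01).
  by apply: eq_integrable => // z _ /=; rewrite scale0r addr0.
have Q0 k : (\int[mu]_z (Q k z)%:E = 0)%E.
  have tk1 : `|t k| <= 1 by rewrite gtr0_norm.
  under eq_integral do rewrite /Q EFinM EFinB.
  rewrite integralZl//; last exact: (integrableB _ (iFs _ tk1) iF0).
  rewrite (integralB _ (iFs _ tk1) iF0)//.
  have := @integral_translation R n (t k *: v) (EFin \o F).
  move=> -> //; last exact: iFs.
    by rewrite subee ?mule0//; exact: integrable_fin_num.
  exact/measurable_EFinP.
have Qlim : (\int[mu]_z (Q k z)%:E)%E @[k --> \oo] -->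
    (\int[mu]_z ('D_v F z)%:E)%E.
  apply: (@dominated_cvg _ _ _ mu setT measurableT _ _ (EFin \o G)) => //.
  - move=> k; apply/measurable_EFinP; apply: measurable_funM => //.
    exact: measurable_funB.
  - move=> z _; apply: cvg_EFin; first by near=> k.
    pose D (h : R) := h^-1 *: ((F \o shift z) (h *: v) - F z).
    have Dt : (D \o t) @ \oo --> 'D_v F z := cvg_comp _ _ tcvg' (dF z).
    apply: cvg_trans Dt; apply: near_eq_cvg; near=> k.
    by rewrite /Q /D /= [z + _]addrC.
  - move=> k z _; rewrite abse_EFin lee_fin /G patchE.
    have [z2|z2] := boolP (z \in box_E 2).
      rewrite normrM ger0_norm ?invr_ge0 ?(ltW (t0 k))//.
      by rewrite mulrC ler_pdivrMr// increment_le.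
    have z2' : ~ box_E 2 z by move=> /mem_set; rewrite (negbTE z2).
    have tk1 : `|t k| <= 1 by rewrite gtr0_norm.
    have := shiftG 0 z; rewrite normr0 => /(_ ler01 z2'); rewrite scale0r addr0.
    by rewrite /Q shiftG// => ->; rewrite subrr !mulr0 normr0.
rewrite /Rintegral (_ : (\int[mu]_z _)%E = 0%E)//.
apply/esym; move: Qlim; under eq_fun do rewrite Q0.
by move=> /(cvg_unique (@ereal_hausdorff R) (cvg_cst _)).
Unshelve. all: by end_near. Qed.

End divergence.

(** * Classical derivatives as weak derivatives *)

Section weak_derivatives.
Context (R : realType) (n : nat).
Local Notation E := ('rV[R]_n * R)%type.
Local Notation mE := ('rV[R]_n * measurableTypeR R)%type.
Local Notation mu := (lebesgue_E R n).
Local Notation HB := (@half_ball R n).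
Implicit Types (f g eta : E -> R).

Lemma smooth_measurable f : smooth_on HB f -> measurable_fun (HB : set mE) f.
Proof.
move=> fS; apply: continuous_measurable_E; first exact: open_half_ball.
by move=> z Hz; have [] := fS [::] z Hz.
Qed.

Lemma smooth_bounded_Lq q f : 0 <= q -> smooth_bounded HB f -> Lq_half_ball q f.
Proof.
move=> q0 [fS /(_ [::])[M fM]].
exact: (Lq_bounded (@measurable_half_ball R n) (@half_ball_lty R n) q0
  (smooth_measurable fS) fM).
Qed.

Lemma test_fun_smooth_bounded eta : test_fun HB eta -> smooth_bounded HB eta.
Proof.
move=> et; split; first by move=> s z _; have [+ _] := et; exact.
by move=> s; have [M hM] := test_fun_bounded (test_fun_pderiv s et); exists M.
Qed.

(** Leibniz rule and [integral_pderiv_eq0] for [f * eta]. Outside the half ball [f] is arbitrary,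
    but there the complement of the compact support is a neighbourhood on which the product
    vanishes, so the product is derivable along [dir R i] everywhere. *)
Lemma integral_by_parts f eta i : smooth_bounded HB f -> test_fun HB eta ->
  \int[mu]_(z in HB) (f z * pderiv [:: i] eta z) =
  - \int[mu]_(z in HB) (pderiv [:: i] f z * eta z).
Proof.
move=> fsb et; have [fS fb] := fsb.
have esb := test_fun_smooth_bounded et.
have [eS [K [cK KU eK]]] := et.
have fsb1 := smooth_bounded_pderiv [:: i] fsb.
have esb1 := smooth_bounded_pderiv [:: i] esb.
have [eS1 [K1 [cK1 KU1 eK1]]] := test_fun_pderiv [:: i] et.
have [Mf hf] := fb [::]; have [Mf1 hf1] := fb [:: i].
have [Me he] := test_fun_bounded et.
have [Me1 he1] := test_fun_bounded (test_fun_pderiv [:: i] et).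
have mf := smooth_measurable fS.
have mf1 := smooth_measurable fsb1.1.
have me := smooth_measurable esb.1.
have me1 := smooth_measurable esb1.1.
have mHB := @measurable_half_ball R n.
have hbF := @half_ball_lty R n.
pose F : E -> R := fun z => f z * eta z.
pose DF : E -> R := fun z =>
  pderiv [:: i] f z * eta z + f z * pderiv [:: i] eta z.
have out z : ~ HB z -> eta z = 0 /\ pderiv [:: i] eta z = 0.
  by move=> zH; split; [apply: eK => /KU|apply: eK1 => /KU1].
have dF z : is_derive z (dir R i) F (DF z).
  have [Hz|Hz] := pselect (HB z).
    have [_ /(_ i) df] := fS [::] z Hz; have [_ /(_ i) de] := eS [::] z I.
    split; first exact: (@derivableM _ _ f eta _ _ df de).
    rewrite (@deriveM _ _ f eta _ _ df de) /DF /=.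
    by rewrite addrC; congr (_ + _); rewrite mulrC.
  have [e0 e1] := out _ Hz.
  have near0 : \forall w \near z, 0 = F w.
    apply: (compl_near cK) => [w Kw|/KU//].
    by rewrite /F eK// mulr0.
  split; first by apply: (near_eq_derivable near0); exact: derivable_cst.
  by rewrite -(near_eq_derive _ near0) derive_cst /DF e0 e1 !mulr0 addr0.
have DFz z : 'D_(dir R i) F z = DF z by have [] := dF z.
have DFE : 'D_(dir R i) F = DF by exact/funext.
have FHB : F = F \_ HB.
  apply/funext => z; rewrite patchE; case: ifPn => // zH.
  rewrite /F (out z _).1 ?mulr0// => Hz.
  by move: zH; rewrite mem_set.
have DFHB : DF = DF \_ HB.
  apply/funext => z; rewrite patchE; case: ifPn => // zH.
  have [|e0 e1] := out z; last by rewrite /DF e0 e1 !mulr0 addr0.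
  by move=> Hz; move: zH; rewrite mem_set.
have bd (a b c d : R) : `|a| <= c -> `|b| <= d -> `|a * b| <= c * d.
  by move=> ac bd; rewrite normrM ler_pM.
have i1 : mu.-integrable HB (EFin \o (fun z => pderiv [:: i] f z * eta z)).
  apply: (@integrable_bounded _ _ _ _ _ mHB hbF _ (Mf1 * Me)).
    exact: measurable_funM.
  by move=> z Hz; exact/bd/he/hf1.
have i2 : mu.-integrable HB (EFin \o (fun z => f z * pderiv [:: i] eta z)).
  apply: (@integrable_bounded _ _ _ _ _ mHB hbF _ (Mf * Me1)).
    exact: measurable_funM.
  by move=> z Hz; exact/bd/he1/hf.
(* A single bound for [F] and for its derivative; with absolute values, each summand is at most the
   total. *)
pose M := `|Mf * Me| + (`|Mf1 * Me| + `|Mf * Me1|).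
have : \int[mu]_z 'D_(dir R i) F z = 0.
  apply: (@integral_pderiv_eq0 R n F i M).
  - by move=> z; have [] := dF z.
  - rewrite FHB; apply/(measurable_restrictT _ mHB); exact: measurable_funM.
  - rewrite DFE DFHB; apply/(measurable_restrictT _ mHB).
    by apply: measurable_funD; exact: measurable_funM.
  - move=> z bz; rewrite FHB patchE; case: ifPn => // /set_mem /half_ball_box.
    by move=> /bz.
  - move=> z; rewrite FHB patchE; case: ifPn => [/set_mem Hz|_].
      rewrite (le_trans (bd _ _ _ _ (hf z Hz) (he z)))//.
      by rewrite (le_trans (ler_norm _))// lerDl addr_ge0.
    by rewrite normr0 /M !addr_ge0.
  - move=> z; rewrite DFz DFHB patchE; case: ifPn => [/set_mem Hz|_].
      rewrite (le_trans (ler_normD _ _))//.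
      apply: (@le_trans _ _ (`|Mf1 * Me| + `|Mf * Me1|)); last by rewrite lerDr.
      rewrite lerD//.
        exact: le_trans (bd _ _ _ _ (hf1 z Hz) (he z)) (ler_norm _).
      exact: le_trans (bd _ _ _ _ (hf z Hz) (he1 z)) (ler_norm _).
    by rewrite normr0 /M !addr_ge0.
rewrite DFE DFHB -Rintegral_mkcond RintegralD//.
by move/eqP; rewrite addrC addr_eq0 => /eqP.
Qed.

(* Each step moves the outermost derivative of [pderiv s eta], hence the
   reversal of [s]. *)
Lemma integral_pderiv f eta r s : smooth_bounded HB f -> test_fun HB eta ->
  \int[mu]_(z in HB) (pderiv r f z * pderiv s eta z) =
  (-1) ^+ size s * \int[mu]_(z in HB) (pderiv (catrev s r) f z * eta z).
Proof.
move=> fsb et; elim: s r => [|i s IHs] r.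
  by rewrite expr0 mul1r.
rewrite (@integral_by_parts (pderiv r f) (pderiv s eta) i)//; first last.
- exact: test_fun_pderiv.
- exact: smooth_bounded_pderiv.
by rewrite pderiv_cat IHs /= exprS mulN1r mulNr.
Qed.

Lemma smooth_bounded_wderiv q f r s : 0 <= q -> smooth_bounded HB f ->
  is_wderiv q s (pderiv r f) (pderiv (catrev s r) f).
Proof.
move=> q0 fsb; split; last by move=> eta; exact: integral_pderiv.
by apply: smooth_bounded_Lq => //; exact: smooth_bounded_pderiv.
Qed.

End weak_derivatives.

(** * Competitors and the Euler-Lagrange equation *)

Section competitors.
Context (R : realType) (n : nat).
Local Notation E := ('rV[R]_n * R)%type.
Local Notation mE := ('rV[R]_n * measurableTypeR R)%type.
Local Notation mu := (lebesgue_E R n).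
Local Notation nu := (lebesgue_rV R n).
Local Notation HB := (@half_ball R n).
Local Notation UB := (@unit_ball R n).
Implicit Types (w v psi h T : E -> R) (q t : R).

Let mHB := @measurable_half_ball R n.
Let finHB := @half_ball_lty R n.
Let oHB := @open_half_ball R n.

Lemma Lq_half_ball_addZ q w w' t : 0 <= q ->
  Lq_half_ball q w -> Lq_half_ball q w' ->
  Lq_half_ball q (fun z => w z + t * w' z).
Proof.
move=> q0 wL w'L.
exact: (@LqD _ _ _ mu HB mHB w (fun z => t * w' z) q q0 wL (LqZ mHB t w'L)).
Qed.

Lemma is_wderiv_addZ q s w w' v v' t : 1 <= q ->
  Lq_half_ball q w -> Lq_half_ball q w' ->
  is_wderiv q s w v -> is_wderiv q s w' v' ->
  is_wderiv q s (fun z => w z + t * w' z) (fun z => v z + t * v' z).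
Proof.
move=> q1 wL w'L [vL vE] [v'L v'E].
have q0 : 0 <= q by exact: le_trans q1.
split; first exact: Lq_half_ball_addZ.
move=> eta et.
have lin (a b e : E -> R) : Lq_half_ball q a -> Lq_half_ball q b ->
    smooth_bounded HB e ->
    \int[mu]_(z in HB) ((a z + t * b z) * e z) =
    \int[mu]_(z in HB) (a z * e z) + t * \int[mu]_(z in HB) (b z * e z).
  move=> aL bL [eS /(_ [::])[M eM]].
  have me := smooth_measurable eS.
  have ia := integrable_Lq_bounded mHB finHB q1 aL me eM.
  have ib := integrable_Lq_bounded mHB finHB q1 bL me eM.
  have itb := integrableZl mHB t ib.
  rewrite -(RintegralZl t mHB ib) -(RintegralD mHB ia itb).
  by apply: eq_Rintegral => z _ /=; ring.
have esb := test_fun_smooth_bounded et.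
rewrite (lin _ _ _ vL v'L esb).
rewrite (lin _ _ _ wL w'L (smooth_bounded_pderiv s esb)) vE// v'E//.
by ring.
Qed.

Lemma sobolev_addZ k q w psi t : 1 <= q -> sobolev k q w ->
  smooth_bounded HB psi -> sobolev k q (fun z => w z + t * psi z).
Proof.
move=> q1 [wL wW] psb; have q0 : 0 <= q by exact: le_trans q1.
have psiL := smooth_bounded_Lq q0 psb.
split; first exact: Lq_half_ball_addZ.
move=> s sk; have [v vw] := wW s sk.
exists (fun z => v z + t * pderiv (catrev s [::]) psi z).
exact: (is_wderiv_addZ t q1 wL psiL vw (smooth_bounded_wderiv [::] s q0 psb)).
Qed.

Lemma is_wlaplacian_addZ q w L psi t : 1 <= q -> Lq_half_ball q w ->
  smooth_bounded HB psi -> is_wlaplacian q w L ->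
  is_wlaplacian q (fun z => w z + t * psi z)
                  (fun z => L z + t * laplacian psi z).
Proof.
move=> q1 wL psb [v vw ->]; have q0 : 0 <= q by exact: le_trans q1.
have psiL := smooth_bounded_Lq q0 psb.
exists (fun i z => v i z + t * pderiv [:: i; i] psi z).
  move=> i; apply: (is_wderiv_addZ t q1 wL psiL (vw i)).
  (* The word [[:: i; i]] is its own reversal, so the derivative obtained is the term of
     [laplacian]. *)
  exact: (smooth_bounded_wderiv [::] [:: i; i] q0 psb).
by apply/funext => z; rewrite /laplacian mulr_sumr -big_split.
Qed.

(** The increments cancel in the difference, so both sequences of integrals are the same. *)
Lemma Lq_cvg_addZ q (f : nat -> E -> R) (g : nat -> E -> R) w psi h t :
  (forall k z, HB z -> g k z = f k z + t * h z) ->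
  (forall z, HB z -> h z = psi z) ->
  Lq_cvg q f w -> Lq_cvg q g (fun z => w z + t * psi z).
Proof.
move=> gE hE; apply: cvg_trans; apply: near_eq_cvg; apply: nearW => k.
apply: eq_integral => z /set_mem Hz.
by rewrite gE// hE//; congr ((`|_| `^ _)%:E); ring.
Qed.

(** Here [psi] may be a [pderiv] with meaningless boundary values; [h] is a representative smooth up
    to the boundary, and it corrects the approximating sequence. The new trace [T'] is prescribed on
    the piece [P] only, so that it can be [T] itself, or zero, when [h] vanishes there. *)
Lemma is_trace_addZ q (P : bpiece R n) w psi h T T' t : 1 <= q ->
  Lq_half_ball q w -> smooth_bounded HB psi -> smooth_upto HB h ->
  (forall z, HB z -> h z = psi z) ->
  measurable_fun UB (T' \o bparam P) ->
  (bint P (fun z => `|T' z| `^ q)%R < +oo)%E ->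
  (forall x, UB x -> T' (bparam P x) = T (bparam P x) + t * h (bparam P x)) ->
  is_trace q P w T -> is_trace q P (fun z => w z + t * psi z) T'.
Proof.
move=> q1 wL psb hu hE mT' foo T'E [_ _ [f [fu fw fd fT]]].
have q0 : 0 <= q by exact: le_trans q1.
have psiL := smooth_bounded_Lq q0 psb.
have [hS _ _] := hu.
split => //; exists (fun k z => f k z + t * h z); split.
- by move=> k; exact: smooth_upto_addZ.
- by apply: Lq_cvg_addZ fw => // z /hE.
- move=> i; have [v vw vcvg] := fd i.
  exists (fun z => v z + t * pderiv [:: i] psi z).
    apply: (is_wderiv_addZ t q1 wL psiL vw).
    exact: (smooth_bounded_wderiv [::] [:: i] q0 psb).
  apply: (@Lq_cvg_addZ _ _ _ _ _ (pderiv [:: i] h)) vcvg.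
    move=> k z Hz; have [fS _ _] := fu k.
    exact: (pderiv_addZ [:: i] t oHB fS hS Hz).
  exact: (eq_pderiv [:: i] oHB hE).
- apply: cvg_trans fT; apply: near_eq_cvg; apply: nearW => k.
  apply: eq_integral => x /set_mem Hx.
  by rewrite T'E//; congr ((`|_| `^ _ * _)%:E); ring.
Qed.

End competitors.

(** * Admissibility of the competitors and the Euler-Lagrange equation *)

Section euler_lagrange.
Context (R : realType) (n : nat).
Local Notation E := ('rV[R]_n * R)%type.
Local Notation mE := ('rV[R]_n * measurableTypeR R)%type.
Local Notation mu := (lebesgue_E R n).
Local Notation nu := (lebesgue_rV R n).
Local Notation HB := (@half_ball R n).
Local Notation UB := (@unit_ball R n).

Let mHB := @measurable_half_ball R n.
Let finHB := @half_ball_lty R n.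
Let oHB := @open_half_ball R n.
Let mUB := @measurable_unit_ball R n.
Let finUB := @unit_ball_lty R n.

Lemma flat_boundary_param (x : 'rV[R]_n) : UB x -> flat_boundary (x, 0 : R).
Proof. by move=> x1; split => //=; rewrite expr0n addr0. Qed.

Lemma cap_boundary_param (x : 'rV[R]_n) : UB x ->
  cap_boundary (bparam (cap R n) x).
Proof.
move=> x1; have s0 : 0 < 1 - sqnorm x by rewrite subr_gt0.
split => /=; last by rewrite sqrtr_gt0.
by rewrite sqr_sqrtr ?(ltW s0)// subrKC.
Qed.

(** The half ball accumulates at [z], so limits from the inside are unique. This turns the condition
    on the limit of [phi_y] into the vanishing of its continuous extension. *)
Lemma limit_flat_boundary (f h : E -> R) (l : R) (z : E) : flat_boundary z ->
  {within closure HB, continuous h} -> (forall w, HB w -> h w = f w) ->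
  f @ within HB (nbhs z) --> l -> h z = l.
Proof.
move=> /flat_boundary_closure cz /subspace_continuousP /(_ z cz) hc hf fl.
have pz : ProperFilter (within HB (nbhs z)) by exact: within_nbhs_proper.
have hz : h @ within HB (nbhs z) --> h z.
  apply: cvg_trans hc; apply: cvg_app; apply: within_subset.
  exact: subset_closure.
apply: (cvg_unique (@norm_hausdorff _ R) hz).
apply: cvg_trans fl; apply: near_eq_cvg.
by rewrite near_withinE; near=> w => Hw; rewrite hf.
Unshelve. all: by end_near. Qed.

(** Near a point of the unit ball, [x |-> (x, 0)] stays in the closure of the half ball, so relative
    continuity of [h] is enough. *)
Lemma continuous_flat_trace (h : E -> R) : {within closure HB, continuous h} ->
  forall x, UB x -> {for x, continuous (fun x => h (x, 0 : R))}.
Proof.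
move=> /subspace_continuousP hc x Ux.
have cx := flat_boundary_closure (flat_boundary_param Ux).
apply: (@cvg_comp _ _ _ (fun y : 'rV[R]_n => (y, 0 : R)) h
  _ (within (closure HB) (nbhs (x, 0 : R)))); last exact: hc.
move=> A [[B1 B2] /= [B1x B2x] BA].
change (\forall y \near x, A (y, 0 : R)).
have Uy : \forall y \near x, UB y.
  by apply: (open_nbhs_nbhs (conj (@open_unit_ball R n) Ux)).
near=> y; apply: (BA (y, 0)) => /=.
  split; first by near: y.
  exact: nbhs_singleton B2x.
by apply/flat_boundary_closure/flat_boundary_param; near: y.
Unshelve. all: by end_near. Qed.

Lemma laplacian_bounded (phi : E -> R) : smooth_bounded HB phi ->
  measurable_fun (HB : set mE) (laplacian phi) /\
  exists M, forall z, HB z -> `|laplacian phi z| <= M.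
Proof.
move=> phib.
have db (i : option 'I_n) := smooth_bounded_pderiv [:: i; i] phib.
split.
  apply: measurable_sum => i; exact: (smooth_measurable (db i).1).
rewrite /laplacian; elim: (index_enum _) => [|i r [M IH]].
  by exists 0 => z _; rewrite big_nil normr0.
have [Mi hMi] := phib.2 [:: i; i].
exists (Mi + M) => z Hz; rewrite big_cons (le_trans (ler_normD _ _))// lerD//.
  exact: hMi.
exact: IH.
Qed.

Variables (lneg lpos p : R) (g u : E -> R).
Hypotheses (lneg0 : 0 <= lneg) (lpos0 : 0 <= lpos) (p1 : 1 < p).
Local Notation q := (qexp p).

Let q1 : 1 <= q. Proof. by rewrite le_max ler1n. Qed.
Let q0 : 0 <= q. Proof. exact: le_trans q1. Qed.

Lemma is_wlaplacian_Lq (w L : E -> R) : is_wlaplacian q w L -> Lq mu HB q L.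
Proof.
move=> [v vw ->]; apply: Lq_sum => // i.
by have [] := vw i.
Qed.

Lemma is_trace_flat_Lq (w T : E -> R) : is_trace q (flat R n) w T ->
  Lq nu UB q (fun x => T (x, 0)).
Proof.
move=> [mT foo _]; split => //; apply: le_lt_trans foo.
by rewrite /bint; under [leRHS]eq_integral do rewrite mulr1.
Qed.

Lemma is_JE (w L T : E -> R) :
  is_wlaplacian q w L -> is_trace q (flat R n) w T ->
  is_J lneg lpos p w (energy mu HB nu UB lneg lpos p L (fun x => T (x, 0))).
Proof.
move=> wL wT; exists L, T; split => //; rewrite /energy; congr (_ + _ * _)%E.
by apply: eq_integral => x _; rewrite mulr1.
Qed.

Variables (phi : E -> R) (t : R).
Hypotheses (phi_smooth : smooth_upto HB phi)
  (phi_cap : forall z, cap_boundary z -> phi z = 0)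
  (phi_flat : forall z, flat_boundary z ->
    pderiv [:: None] phi @ within HB (nbhs z) --> (0 : R)).

Let phib : smooth_bounded HB phi.
Proof.
exact: smooth_upto_bounded (@compact_closure_half_ball R n) phi_smooth.
Qed.

(** On the cap [phi] vanishes, so the trace [T] shared by [u] and [g] is kept; on the flat part the
    extension of [phi_y] vanishes, so the trace of the normal derivative remains zero. *)
Lemma admissible_addZ : admissible p g u ->
  admissible p g (fun z => u z + t * phi z).
Proof.
move=> [uS [T uT gT] [v uv vT]].
have uL : Lq_half_ball q u by have [] := uS.
have vL : Lq_half_ball q v by have [] := uv.
split; first exact: sobolev_addZ.
- exists T => //; have [mT foo _] := uT.
  apply: (@is_trace_addZ R n q (cap R n) u phi phi T) => // x Ux.
  by rewrite phi_cap ?mulr0 ?addr0//; exact: cap_boundary_param.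
have [h hu hE] := smooth_upto_pderiv [:: None] oHB phi_smooth.
have [_ hc _] := hu.
exists (fun z => v z + t * pderiv [:: None] phi z).
  apply: (is_wderiv_addZ t q1 uL _ uv).
    exact: smooth_bounded_Lq.
  exact: (smooth_bounded_wderiv [::] [:: None] q0 phib).
have [mT foo _] := vT.
apply: (@is_trace_addZ R n q (flat R n) v _ h (cst 0)) => //.
  exact: smooth_bounded_pderiv.
move=> x Ux; rewrite /= (@limit_flat_boundary (pderiv [:: None] phi) h 0)//.
- by rewrite mulr0 addr0.
- exact: flat_boundary_param.
- by apply: phi_flat; exact: flat_boundary_param.
Qed.

Lemma flat_trace_bounded : measurable_fun UB (fun x => phi (x, 0 : R)) /\
  exists M, forall x, UB x -> `|phi (x, 0 : R)| <= M.
Proof.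
have [_ phic _] := phi_smooth; split.
  exact: (continuous_measurable_rV (@open_unit_ball R n)
    (continuous_flat_trace phic)).2.
have [M hM] := compact_continuous_bounded (@compact_closure_half_ball R n) phic.
by exists M => x /flat_boundary_param/flat_boundary_closure/hM.
Qed.

Lemma is_J_addZ (L T : E -> R) : Lq_half_ball q u ->
  is_wlaplacian q u L -> is_trace q (flat R n) u T ->
  is_J lneg lpos p (fun z => u z + t * phi z)
    (energy mu HB nu UB lneg lpos p (fun z => (L z + t * laplacian phi z)%R)
      (fun x => (T (x, 0) + t * phi (x, 0))%R)).
Proof.
move=> uL uLap uT; have [mphi [M phiM]] := flat_trace_bounded.
have TL : Lq nu UB q (fun x => T (x, 0) + t * phi (x, 0)).
  exact: (Lq_addZ mUB finUB t (is_trace_flat_Lq uT) mphi phiM).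
apply: (@is_JE _ _ (fun z => T z + t * phi z)).
  exact: is_wlaplacian_addZ.
have [mT foo] := TL.
apply: (@is_trace_addZ R n q (flat R n) u phi phi T) => //.
by rewrite /bint; under eq_integral do rewrite mulr1; exact: foo.
Qed.

End euler_lagrange.

Theorem theorem2p4 (R : realType) (n : nat) (lneg lpos p : R)
  (g u : 'rV[R]_n * R -> R)
  (lneg_gt0 : 0 < lneg) (lpos_gt0 : 0 < lpos) (p_gt1 : 1 < p)
  (gW : sobolev 2 (qexp p) g) (gN : flat_neumann (qexp p) g)
  (umin : is_minimizer lneg lpos p g u) :
  weak_solution lneg lpos p g u.
Proof.
have ln0 := ltW lneg_gt0; have lp0 := ltW lpos_gt0.
have mHB := @measurable_half_ball R n; have finHB := @half_ball_lty R n.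
have mUB := @measurable_unit_ball R n; have finUB := @unit_ball_lty R n.
have [uA [j [L [T [uL uT jE]]] jmin]] := umin.
have [uS ug uN] := uA; have [uLq _] := uS.
(* The Laplacian and the trace are those that witness the minimal value [j], so that [jmin] becomes
   a comparison of energies starting from this pair. *)
split=> //; exists L, T; split=> // phi phis phicap phiflat.
have LL := is_wlaplacian_Lq uL; have TL := is_trace_flat_Lq uT.
have phib := smooth_upto_bounded (@compact_closure_half_ball R n) phis.
have [mpsi [M1 psiM1]] := laplacian_bounded phib.
have [mphi [M2 phiM2]] := flat_trace_bounded phis.
pose M := Num.max M1 M2.
have psiM z : half_ball z -> `|laplacian phi z| <= M.
  by move=> /psiM1; rewrite le_max => ->.
have phiM x : unit_ball x -> `|phi (x, 0)| <= M.
  by move=> /phiM2; rewrite le_max orbC => ->.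
pose J := energy (lebesgue_E R n) (@half_ball R n) (lebesgue_rV R n)
  (@unit_ball R n) lneg lpos p.
have jJ : j = J L (fun x => T (x, 0)).
  rewrite jE /J /energy; congr (_ + _ * _)%E.
  by apply: eq_integral => x _; rewrite mulr1.
have Jmin (t : R) : (J L (fun x => T (x, 0%R)) <=
    J (fun z => (L z + t * laplacian phi z)%R)
      (fun x => (T (x, 0%R) + t * phi (x, 0%R))%R))%E.
  rewrite -jJ; apply: (jmin (fun z => u z + t * phi z)).
    exact: admissible_addZ.
  exact: is_J_addZ.
have le1 := first_variation_le mHB finHB mUB finUB ln0 lp0 p_gt1 LL TL
  mpsi psiM mphi phiM (fun t _ => Jmin t).
have psiMN z : half_ball z -> `|- laplacian phi z| <= M.
  by rewrite normrN; exact: psiM.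
have phiMN x : unit_ball x -> `|- phi (x, 0)| <= M.
  by rewrite normrN; exact: phiM.
(* A step [t] along [- phi] is a step [- t] along [phi], and [Jmin] holds for steps of either
   sign. *)
have JminN (t : R) : 0 < t -> (J L (fun x => T (x, 0%R)) <=
    J (fun z => (L z + t * - laplacian phi z)%R)
      (fun x => (T (x, 0%R) + t * - phi (x, 0%R))%R))%E.
  move=> _; under [X in (_ <= J X _)%E]eq_fun do rewrite mulrN -mulNr.
  under [X in (_ <= J _ X)%E]eq_fun do rewrite mulrN -mulNr.
  exact: Jmin.
have le2 := first_variation_le mHB finHB mUB finUB ln0 lp0 p_gt1 LL TL
  (measurable_funN mpsi) psiMN (measurable_funN mphi) phiMN JminN.
have q1 : 1 <= qexp p by rewrite le_max ler1n.
have ig := integrable_boundary_force mUB finUB ln0 lp0 p_gt1 TL mphi phiM.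
have iL := integrable_Lq_bounded mHB finHB q1 LL mpsi psiM.
apply/eqP; rewrite eq_le; apply/andP; split; last exact: le1.
move: le2; rewrite /= (Rintegral_mulrN mUB ig) (Rintegral_mulrN mHB iL).
by rewrite lerN2.
Qed.
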